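(* Let $\alpha\in(0,1)$ and let $\{P_m^{(\alpha)}(z)\}_{m=0}^\infty$ be the sequence of polynomials generated by $$\sum_{m=0}^{\infty}P_m^{(\alpha)}(z)t^m=\frac{1}{(1+t+zt^3)^{\alpha}}.$$ For all sufficiently large $m$, all the zeros of $P_m^{(\alpha)}(z)$ lie on the real interval $(-\infty,-4/27)$. Moreover, the limiting probability density function of the zeros of $P_m^{(\alpha)}(z)$ is $$-\frac{3x\sqrt{x+1}}{2\pi z(3+2x)\sqrt{3-x}},\qquad z\in(-\infty,-4/27),$$ where $$x=\frac{\sqrt[3]{\sqrt{3}\sqrt{27z^{4}+4z^{3}}-9z^{2}}}{\sqrt[3]{2}\,3^{2/3}z}-\frac{\sqrt[3]{\frac{2}{3}}}{\sqrt[3]{\sqrt{3}\sqrt{27z^{4}+4z^{3}}-9z^{2}}}$$ is the unique real zero in $t$ of $1+t+zt^3$.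
   Context: The generating function is understood as a power series in $t$ near $t=0$ with the principal branch of the power (value $1$ at $t=0$). Cube roots of real numbers are real cube roots. For $z\in(-\infty,-4/27)$ and small $\varepsilon>0$, let $N_{m,\varepsilon}(z)$ denote the number of zeros of $P_m^{(\alpha)}$ on the interval $(z,z+\varepsilon)$. The limiting probability density function of the zeros of $P_m^{(\alpha)}$ evaluated at $z\in(-\infty,-4/27)$ is defined as $$\lim_{\varepsilon\to0}\frac{1}{\varepsilon}\lim_{m\to\infty}\frac{N_{m,\varepsilon}(z)}{\lfloor m/3\rfloor}.$$ *)

(* Defs.v *)
From mathcomp Require Import all_boot all_order all_algebra.
From mathcomp Require Import all_classical all_reals all_analysis.
From mathcomp Require Import complex polyrcf.

Set Implicit Arguments.
Unset Strict Implicit.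
Unset Printing Implicit Defensive.

Import Order.TTheory GRing.Theory Num.Theory.
Import numFieldTopology.Exports numFieldNormedType.Exports.

Local Open Scope classical_set_scope.
Local Open Scope ring_scope.

(* The base is positive for t near 0, so the real power [`^] is the principal
   branch there.  Real z and t already determine the polynomials P m. *)
Definition generated_by (R : realType) (alpha : R) (P : nat -> {poly R}) : Prop :=
  forall z : R, \forall t \near (0 : R),
    series (fun m => (P m).[z] * t ^+ m) @ \oo
      --> ((1 + t + z * t ^+ 3) `^ alpha)^-1.

Definition cbrt (R : realType) (x : R) : R := Num.sg x * `|x| `^ 3^-1.

(* Zeros in the open interval ]a, b[, counted with multiplicity: [roots p a b]
   lists the distinct ones in that interval. *)
Definition nb_zeros (R : realType) (p : {poly R}) (a b : R) : nat :=
  (\sum_(r <- polyrcf.roots p a b) mup r p)%N.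

(* The value at z of the limiting density of the zeros of the P m is d: an
   iterated limit, the inner one being required to exist for all small eps. *)
Definition is_limiting_density (R : realType) (P : nat -> {poly R}) (z d : R) :
    Prop :=
  exists L : R -> R,
    (\forall eps \near 0^'+,
       (nb_zeros (P m) z (z + eps))%:R / (m %/ 3)%:R @[m --> \oo] --> L eps) /\
    eps^-1 * L eps @[eps --> 0^'+] --> d.

Definition real_zero (R : realType) (z : R) : R :=
  let u := Num.sqrt 3 * Num.sqrt (27 * z ^+ 4 + 4 * z ^+ 3) - 9 * z ^+ 2 in
  cbrt u / (cbrt 2 * 3 `^ (2 / 3) * z) - cbrt (2 / 3) / cbrt u.

Definition zero_density (R : realType) (z : R) : R :=
  let x := real_zero z in
  - (3 * x * Num.sqrt (x + 1)
     / (2 * pi * z * (3 + 2 * x) * Num.sqrt (3 - x))).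

(* Main.v *)
Require Import Defs.
From mathcomp Require Import all_boot all_order all_algebra.
From mathcomp Require Import all_classical all_reals all_analysis.
From mathcomp Require Import complex polyrcf.
From mathcomp Require Import ring lra.

Import Order.TTheory GRing.Theory Num.Theory.
Import numFieldTopology.Exports numFieldNormedType.Exports.

Local Open Scope classical_set_scope.
Local Open Scope ring_scope.

Set Implicit Arguments.
Unset Strict Implicit.

(** Put Q_m = (-1)^m P_m. The differential equation of the generating function
    in t gives
      (m+3) Q_(m+3) = (m+2+alpha) Q_(m+2) + (m + 3 alpha) z Q_m,
    with positive coefficients.

    Real zeros. If B is an alternating form with B(zf, zg) = k B(f, g), k > 0,
    and B(f, zf) >= 0, the recurrence propagates the inequalities
    B(Q_i, Q_j) >= 0 and B(Q_j, z Q_i) > 0 for i < j <= i + 2. Applied to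
    Im w * Im(conj f(w) * g(w)), this shows that Q_m(w) <> 0 for Im w <> 0;
    applied to the Wronskian at z < 0, that the zeros are simple and interlace.
    At z = -4/27 the recurrence is a consequence of one of order two with
    positive coefficients, and Q_(m+1) / Q_m is increasing as long as Q_m > 0,
    so there is no zero in [-4/27, +oo[.

    Density. By interlacing, the number N_m(z) of zeros of Q_m in ]z, 0[ is the
    number of sign changes of Q_0(z), ..., Q_m(z), and there are never two
    consecutive ones. Writing x = 1/k for the real root, the limiting
    characteristic polynomial l^3 - l^2 - z has the roots -k and r e^(+-i phi)
    with cos phi = sqrt(1+x)/2. The absence of consecutive sign changes keeps
    the sequence away from the mode (-k)^m, so the component along the complex
    pair turns by phi + o(1) at each step and N_m(z) / m --> phi(z) / pi.
    The density is - (3/pi) phi'(z). *)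

(** * Real-rootedness and interlacing *)

(** Expanding [q m.+3] by the recurrence in each slot gives [B (q m.+2) (q m.+2) = 0] or a
    combination, with positive coefficients, of quantities already known to be nonnegative, one of
    them positive. *)
Lemma alternating_recurrence_gt0 (R : realFieldType) (V : lmodType R)
    (B : V -> V -> R) (X : V -> V) (k : R) (a b : nat -> R) (q : nat -> V) :
  (forall u v w c d, B u (c *: v + d *: w) = c * B u v + d * B u w) ->
  (forall u v, B v u = - B u v) ->
  (forall u v, B (X u) (X v) = k * B u v) -> 0 < k ->
  (forall u, 0 <= B u (X u)) ->
  (forall m, 0 < a m) -> (forall m, 0 < b m) ->
  (forall m, q m.+3 = a m *: q m.+2 + b m *: X (q m)) ->
  B (q 0) (q 1) = 0 -> B (q 1) (q 2) = 0 -> B (q 0) (q 2) = 0 ->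
  0 < B (q 1) (X (q 0)) -> 0 < B (q 2) (X (q 1)) -> 0 < B (q 2) (X (q 0)) ->
  0 < B (q 2) (X (q 2)) ->
  forall m, 0 < B (q m.+2) (q m.+3) /\ 0 < B (q m.+1) (q m.+3).
Proof.
move=> Blin Balt BXX k0 BX a0 b0 rec z01 z12 z02 p10 p21 p20 p22.
have Blinl u v w c d : B (c *: v + d *: w) u = c * B v u + d * B w u.
  by rewrite Balt Blin (Balt v u) (Balt w u); ring.
have step m : 0 <= B (q m.+1) (q m.+2) -> 0 < B (q m.+2) (X (q m)) ->
    0 < B (q m.+1) (X (q m)) ->
    0 < B (q m.+2) (q m.+3) /\ 0 < B (q m.+1) (q m.+3).
  move=> h12 h20 h10; rewrite rec !Blin.
  have -> : B (q m.+2) (q m.+2) = 0 by have := Balt (q m.+2) (q m.+2); lra.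
  rewrite mulr0 add0r mulr_gt0//; split=> //.
  by rewrite ltr_wpDl ?mulr_gt0// mulr_ge0// ltW.
(* The final disjunction keeps [B (q m.+3) (X (q m.+2))] strictly positive: both of its terms are
   only nonnegative in general. The left case serves the start, where the forms among [q 0], [q 1],
   [q 2] vanish; the right case serves from then on. *)
suff inv m : [/\ 0 <= B (q m) (q m.+1), 0 <= B (q m.+1) (q m.+2),
    0 <= B (q m) (q m.+2), 0 < B (q m.+2) (X (q m)) &
    [/\ 0 < B (q m.+1) (X (q m)), 0 < B (q m.+2) (X (q m.+1)) &
    0 < B (q m.+2) (X (q m.+2)) \/ 0 < B (q m) (q m.+2)]].
  by move=> m; case: (inv m) => ? ? ? ? [? ? _]; exact: step.
elim: m => [|m [h01 h12 h02 p20' [p10' p21' d]]].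
  by rewrite z01 z12 z02; split=> //; split=> //; left.
have [h23 h13] := step _ h12 p20' p10'.
split; [by []|exact: ltW|exact: ltW| |split; [exact: p21'| |by right]].
- rewrite rec Blinl BXX ltr_wpDr ?mulr_gt0// mulr_ge0 ?(ltW (b0 m))//.
  by rewrite mulr_ge0// ltW.
- rewrite rec Blinl BXX.
  have kb : 0 < b m * k by rewrite mulr_gt0.
  rewrite mulrA; case: d => h.
    by rewrite ltr_wpDr ?mulr_gt0// mulr_ge0// ltW.
  by rewrite ltr_wpDl ?mulr_gt0// mulr_ge0// ltW.
Qed.

Definition wronskian (R : nzRingType) (f g : {poly R}) : {poly R} :=
  f * g^`() - f^`() * g.

Record trinomial_sequence (R : realFieldType) (a b : nat -> R)
    (Q : nat -> {poly R}) : Prop := TrinomialSequence {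
  trin_a_gt0 : forall m, 0 < a m;
  trin_b_gt0 : forall m, 0 < b m;
  trin_init : forall m, (m < 3)%N -> exists2 c, 0 < c & Q m = c%:P;
  trin_rec : forall m, Q m.+3 = a m *: Q m.+2 + b m *: ('X * Q m) }.

Section trinomial.
Variables (R : realType) (a b : nat -> R) (Q : nat -> {poly R}).
Hypothesis HQ : trinomial_sequence a b Q.

Let a_gt0 := trin_a_gt0 HQ.
Let b_gt0 := trin_b_gt0 HQ.
Let recQ := trin_rec HQ.

(** The Wronskian satisfies W(Xf, Xg) = X^2 W(f, g) and W(f, Xf) = f^2, so its value at x is an
    admissible form with k = x^2. *)
Lemma trinomial_wronskian_gt0 m x : x < 0 ->
  0 < (wronskian (Q m.+2) (Q m.+3)).[x] /\
  0 < (wronskian (Q m.+1) (Q m.+3)).[x].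
Proof.
move=> x0.
have [c0 c0p E0] := @trin_init _ _ _ _ HQ 0%N isT.
have [c1 c1p E1] := @trin_init _ _ _ _ HQ 1%N isT.
have [c2 c2p E2] := @trin_init _ _ _ _ HQ 2%N isT.
apply: (@alternating_recurrence_gt0 R {poly R}
  (fun f g => (wronskian f g).[x]) (fun f => 'X * f) (x ^+ 2) a b Q) => //.
all: rewrite /wronskian.
- move=> u v w c d; rewrite !poly.derivE !hornerE /=; ring.
- move=> u v; rewrite !hornerE /=; ring.
- move=> u v; rewrite !poly.derivE !hornerE /=; ring.
- by rewrite -sqrrN exprn_gt0 ?oppr_gt0.
- move=> u; rewrite !poly.derivE !hornerE /=.
  suff -> : forall s t : R, s * (s + x * t) - t * x * s = s ^+ 2.
    exact: sqr_ge0.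
  by move=> s t; ring.
- by rewrite E0 E1 !poly.derivE !hornerE /=; ring.
- by rewrite E1 E2 !poly.derivE !hornerE /=; ring.
- by rewrite E0 E2 !poly.derivE !hornerE /=; ring.
all: rewrite ?E0 ?E1 ?E2 !poly.derivE !hornerE /=; nra.
Qed.

(** With B(f, g) = Im w * Im(conj f(w) * g(w)), multiplication by X scales B by |w|^2, and B(f, Xf)
    = (Im w)^2 |f(w)|^2. A zero of [Q m.+3] at w would make [B (Q m.+1) (Q m.+3)] vanish. *)
Lemma trinomial_real_rooted m (w : R[i]) :
  root (map_poly (real_complex R) (Q m)) w -> complex.Im w = 0.
Proof.
have [c0 c0p E0] := @trin_init _ _ _ _ HQ 0%N isT.
have [c1 c1p E1] := @trin_init _ _ _ _ HQ 1%N isT.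
have [c2 c2p E2] := @trin_init _ _ _ _ HQ 2%N isT.
case: w => w1 w2 rw /=; apply/eqP/negP => /negP w0.
pose w := Complex w1 w2.
pose ev (f : {poly R}) := (map_poly (real_complex R) f).[w].
have evD c d f g : ev (c *: f + d *: g) =
    real_complex R c * ev f + real_complex R d * ev g.
  by rewrite /ev rmorphD /= !map_polyZ !hornerE.
have evX f : ev ('X * f) = w * ev f.
  by rewrite /ev rmorphM /= map_polyX !hornerE.
have evC c : ev c%:P = real_complex R c by rewrite /ev map_polyC !hornerE.
pose B f g := w2 * (complex.Re (ev f) * complex.Im (ev g) -
  complex.Im (ev f) * complex.Re (ev g)).
have B_gt0 n : 0 < B (Q n.+2) (Q n.+3) /\ 0 < B (Q n.+1) (Q n.+3).
  have w2p : 0 < w2 ^+ 2 by rewrite exprn_even_gt0.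
  have pos c d : 0 < c -> 0 < d -> 0 < w2 *
      (complex.Re (real_complex R c) * complex.Im (w * real_complex R d) -
       complex.Im (real_complex R c) * complex.Re (w * real_complex R d)).
    move=> c_gt0 d_gt0 /=.

 suff -> : w2 * (c * (w1 * 0 + w2 * d) - 0 * (w1 * d - w2 * 0)) =
      w2 ^+ 2 * (c * d)by rewrite mulr_gt0 // mulr_gt0.
    by ring.
  apply: (@alternating_recurrence_gt0 R {poly R} B (fun f => 'X * f)
     (w1 ^+ 2 + w2 ^+ 2) a b Q) => //; rewrite /B.
  - move=> u v x c d; rewrite !evD.
    case: (ev u) (ev v) (ev x) => [? ?] [? ?] [? ?] /=.
    ring.
  - by move=> u v; ring.
  - move=> u v; rewrite !evX; case: (ev u) (ev v) => [? ?] [? ?] /=.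
    ring.
  - by rewrite ltr_wpDl// sqr_ge0.
  - move=> u; rewrite !evX; case: (ev u) => [u1 u2] /=.
    suff -> : w2 * (u1 * (w1 * u2 + w2 * u1) - u2 * (w1 * u1 - w2 * u2)) =
       w2 ^+ 2 * (u1 ^+ 2 + u2 ^+ 2) by rewrite mulr_ge0 ?addr_ge0 ?sqr_ge0.
    ring.
  - by rewrite E0 E1 !evC /=; ring.
  - by rewrite E1 E2 !evC /=; ring.
  - by rewrite E0 E2 !evC /=; ring.
  - by rewrite /= !evX E0 E1 !evC; exact: pos.
  - by rewrite /= !evX E1 E2 !evC; exact: pos.
  - by rewrite /= !evX E0 E2 !evC; exact: pos.
  - by rewrite /= !evX E2 !evC; exact: pos.
have Q0 : ev (Q m) = 0 by apply/eqP.
case: m rw Q0 => [|[|[|m]]] _.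
- by rewrite E0 evC => -[] c00; rewrite c00 ltxx in c0p.
- by rewrite E1 evC => -[] c00; rewrite c00 ltxx in c1p.
- by rewrite E2 evC => -[] c00; rewrite c00 ltxx in c2p.
- by move=> Q0; have [+ _] := B_gt0 m; rewrite /B Q0 /= !mulr0 subrr mulr0 ltxx.
Qed.

Lemma trinomial_gt0 m x : 0 <= x -> 0 < (Q m).[x].
Proof.
move=> x0; suff H n : [/\ 0 < (Q n).[x], 0 < (Q n.+1).[x] & 0 < (Q n.+2).[x]].
  by case: (H m).
elim: n => [|n [h0 h1 h2]].
  have [c0 c0p E0] := @trin_init _ _ _ _ HQ 0%N isT.
  have [c1 c1p E1] := @trin_init _ _ _ _ HQ 1%N isT.
  have [c2 c2p E2] := @trin_init _ _ _ _ HQ 2%N isT.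
  by rewrite E0 E1 E2 !hornerE.
split => //; rewrite recQ !hornerE; apply: ltr_wpDr; last exact: mulr_gt0.
by apply: mulr_ge0; rewrite ?mulr_ge0// ltW.
Qed.

Lemma trinomial_root_simple m x : (2 < m)%N -> x < 0 -> root (Q m) x ->
  (Q m)^`().[x] != 0.
Proof.
case: m => [|[|[|m]]]// _ x0 /eqP Qx; apply/eqP => Q'x.
have [+ _] := trinomial_wronskian_gt0 m x0.
by rewrite /wronskian !hornerE Qx Q'x !mulr0 subrr ltxx.
Qed.

End trinomial.

(** * Counting zeros of interlacing polynomials *)

(** Induction on s: the element of t in the first gap is spent, and the later gaps only use elements
    of t to the right of that gap. *)
Lemma size_interleaved d (T : orderType d) (s t : seq T) :
  sorted <%O s ->
  (forall x y, x \in s -> y \in s -> (x < y)%O ->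
     exists2 u, u \in t & (x < u < y)%O) ->
  (size s <= (size t).+1)%N.
Proof.
elim: s t => [//|x [|y s] IH] t /= ; first by [].
move=> /andP[xy ss] H.
have sub v : v \in y :: s -> v \in [:: x, y & s].
  by rewrite [in X in _ -> X]inE orbC => ->.
have [u ut /andP[xu uy]] := H x y (mem_head _ _) (sub _ (mem_head _ _)) xy.
have ty : (size [seq v <- t | (y < v)%O] < size t)%N.
  rewrite size_filter -(count_predC (fun v => (y < v)%O) t) -addn1 leq_add2l.
  rewrite -has_count; apply/hasP; exists u => //=.
  by rewrite -leNgt ltW.
rewrite ltnS; apply: leq_trans ty; apply: IH => // v w vs ws vw.
have [r rt /andP[vr rw]] := H v w (sub _ vs) (sub _ ws) vw.
exists r; last by rewrite vr.
rewrite mem_filter rt andbT; apply: le_lt_trans vr.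
move: vs; rewrite inE => /predU1P[->//|vs].
by apply/ltW; apply: (allP (order_path_min lt_trans ss)).
Qed.

Section sturm.
Variable R : realType.
Implicit Types (f g p : {poly R}) (x y z : R).

(** The derivative of g / f is W(f, g) / f^2. *)
Lemma ratio_wronskian_lt f g x y : x < y ->
  {in `]x, y[, forall u, 0 < (wronskian f g).[u]} ->
  {in `[x, y], forall u, f.[u] != 0} ->
  g.[x] / f.[x] < g.[y] / f.[y].
Proof.
move=> xy W f0.
pose h u := g.[u] / f.[u].
have dh u : f.[u] != 0 -> is_derive u 1 h ((wronskian f g).[u] / f.[u] ^+ 2).
  move=> fu; have df := is_derive_poly f u; have dg := is_derive_poly g u.
  have dfV := is_deriveV fu.
  have -> : h = horner g * (fun u => (horner f u)^-1) by [].
  apply: is_derive_eq.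
  by rewrite /GRing.scale /= /wronskian !(hornerD, hornerN, hornerM); field.
have [||c cxy] := @MVT R h (fun u => (wronskian f g).[u] / f.[u] ^+ 2) x y xy.
- by move=> u uxy; apply/dh/f0; apply: subset_itv_oo_cc.
- apply: continuous_in_subspaceT => u; rewrite inE/= => uxy.
  apply/differentiable_continuous/derivable1_diffP.
  have ? := dh u (f0 _ uxy); exact: ex_derive.
move=> E; rewrite -subr_gt0 -/(h x) -/(h y) E mulr_gt0 ?subr_gt0//.
rewrite divr_gt0 ?W// exprn_even_gt0//= f0//; apply: subset_itv_oo_cc cxy.
Qed.

(** Otherwise g / f would increase strictly from 0 to 0. At the end points f cannot vanish together
    with g, as the Wronskian is nonzero there. *)
Lemma wronskian_root_between f g x y : x < y ->
  {in `[x, y], forall u, 0 < (wronskian f g).[u]} ->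
  g.[x] = 0 -> g.[y] = 0 -> exists2 u, x < u < y & root f u.
Proof.
move=> xy W gx gy.
have W0 u : u \in `[x, y] -> g.[u] = 0 -> f.[u] != 0.
  move=> /W + gu; apply: contraTneq => fu.
  by rewrite /wronskian !hornerE gu fu mul0r mulr0 subrr ltxx.
apply: contrapT => nf.
suff: g.[x] / f.[x] < g.[y] / f.[y] by rewrite gx gy !mul0r ltxx.
apply: ratio_wronskian_lt => // u uxy; first by apply: W; apply: subset_itv_oo_cc.
move: (uxy); rewrite in_itv/= => /andP[].
rewrite le_eqVlt => /predU1P[<- _|xu].
  by apply: W0 => //; rewrite in_itv/= lexx ltW.
rewrite le_eqVlt => /predU1P[->|uy].
  by apply: W0 => //; rewrite in_itv/= lexx ltW.
by apply/negP => fu; apply: nf; exists u; rewrite ?xu.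
Qed.

(** Without a root of g, the quotient f / (- g) would increase from 0 to a negative value. The
    interval is open at y because the Wronskian is controlled only on the negative axis and y = 0 is
    the intended end point. *)
Lemma wronskian_root_right f g x y : x < y ->
  {in `[x, y[, forall u, 0 < (wronskian f g).[u]} ->
  f.[x] = 0 -> 0 < f.[y] -> 0 < g.[y] -> exists2 u, x < u < y & root g u.
Proof.
move=> xy W fx fy gy; apply: contrapT => ng.
suff: f.[x] / (- g).[x] < f.[y] / (- g).[y].
  by rewrite fx mul0r hornerN invrN mulrN oppr_gt0 ltNge divr_ge0 ?ltW.
apply: ratio_wronskian_lt => // u uxy.
  suff -> : wronskian (- g) f = wronskian f g.
    by apply: W; move: uxy; rewrite !in_itv/= => /andP[/ltW-> ->].
  by rewrite /wronskian derivN; ring.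
rewrite hornerN oppr_eq0; move: (uxy); rewrite in_itv/= => /andP[].
rewrite le_eqVlt => /predU1P[<- _|xu].
  have: 0 < (wronskian f g).[x] by rewrite W// in_itv/= lexx.
  by apply: contraTneq => gx; rewrite /wronskian !hornerE gx fx mul0r mulr0 subrr ltxx.
rewrite le_eqVlt => /predU1P[->|uy]; first by rewrite gt_eqF.
by apply/negP => gu; apply: ng; exists u; rewrite ?xu.
Qed.

Lemma size_roots_interlaced f g z b : z < b ->
  {in `]z, b[, forall u, 0 < (wronskian f g).[u]} -> 0 < f.[b] -> 0 < g.[b] ->
  (size (roots f z b) <= size (roots g z b) <= (size (roots f z b)).+1)%N.
Proof.
move=> zb W fb gb.
have f0 : f != 0 by apply: contraTneq fb => ->; rewrite horner0 ltxx.
have g0 : g != 0 by apply: contraTneq gb => ->; rewrite horner0 ltxx.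
apply/andP; split; last first.
  apply: size_interleaved; first exact: sorted_roots.
  move=> x y xr yr xy.
  have := roots_in xr; have := roots_in yr; rewrite !in_itv/=.
  move=> /andP[zy yb] /andP[zx xb].
  have [|||u /andP[xu uy] fu] := @wronskian_root_between f g x y xy.
  - move=> u; rewrite in_itv/= => /andP[xu uy]; apply: W; rewrite in_itv/=.
    by rewrite (lt_le_trans zx)// (le_lt_trans uy).
  - exact/rootP/root_roots/xr.
  - exact/rootP/root_roots/yr.
  - exists u; last by rewrite xu.
    by rewrite in_roots fu f0 in_itv/= (lt_trans zx)// (lt_trans uy).
(* Counting b as one more point after the roots of f creates a last gap that also contains a root of
   g; this gains the missing unit. *)
rewrite -ltnS -(size_rcons _ b); apply: size_interleaved.
  case E: (roots f z b) => [//|x s] /=.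
  rewrite rcons_path; have := sorted_roots z b f; rewrite E /= => ->/=.
  have : last x s \in roots f z b by rewrite E mem_last.
  by move=> /roots_in; rewrite in_itv/= => /andP[].
move=> x y; rewrite !mem_rcons !inE => /predU1P[->|xr].
  case/predU1P => [->|yr]; first by rewrite ltxx.
  by move: (roots_in yr); rewrite in_itv/= => /andP[_ /lt_trans h /h]; rewrite ltxx.
have := roots_in xr; rewrite in_itv/= => /andP[zx xb].
have fx : f.[x] = 0 by apply/rootP/root_roots/xr.
have [||||u /andP[xu ub] gu] := @wronskian_root_right f g x b xb => //.
  move=> u; rewrite in_itv/= => /andP[xu ub]; apply: W; rewrite in_itv/=.
  by rewrite (lt_le_trans zx).
have gx0 v : z < v -> v < b -> root g v -> v \in roots g z b.
  by move=> zv vb gv; rewrite in_roots gv g0 in_itv/= zv vb.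
case/predU1P => [->|yr] xy.
  by exists u; rewrite ?xu// gx0// (lt_trans zx).
have := roots_in yr; rewrite in_itv/= => /andP[zy yb].
have [|||v /andP[xv vy] gv] := @wronskian_root_between (- g) f x y xy.
- move=> v; rewrite in_itv/= => /andP[xv vy].
  suff -> : wronskian (- g) f = wronskian f g.
    by apply: W; rewrite in_itv/= (lt_le_trans zx)// (le_lt_trans vy).
  by rewrite /wronskian derivN; ring.
- exact: fx.
- exact/rootP/root_roots/yr.
- exists v; rewrite ?xv// gx0//; first exact: (lt_trans zx).
    exact: (lt_trans vy).
  by rewrite rootE -oppr_eq0 -hornerN.
Qed.

(** Write p as h times the product of X - u over its roots u in the interval. Simplicity of the
    roots leaves h without zeros on [z, b], so h stays positive, and each factor X - u is negative
    at z and positive at b. *)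
Lemma sign_size_roots p z b : z < b ->
  {in `]z, b[, forall u, root p u -> p^`().[u] != 0} -> 0 < p.[b] ->
  p.[z] = (-1) ^+ size (roots p z b) * `|p.[z]|.
Proof.
move=> zb simple pb; have [->|pz] := eqVneq p.[z] 0; first by rewrite normr0 mulr0.
have p0 : p != 0 by apply: contraTneq pb => ->; rewrite horner0 ltxx.
set s := roots p z b.
have us : poly.uniq_roots s by rewrite uniq_rootsE uniq_roots.
have ps : all (root p) s by apply/allP => x; exact: root_roots.
have [h Eh] := uniq_roots_prod_XsubC ps us.
have h0 u : z <= u <= b -> h.[u] != 0.
  move=> /andP[]; rewrite le_eqVlt => /predU1P[<- _|zu].
    by apply: contraNneq pz => hz; rewrite Eh hornerM hz mul0r.
  rewrite le_eqVlt => /predU1P[->|ub].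
    by apply: contraTneq pb => hb; rewrite Eh hornerM hb mul0r ltxx.
  apply/eqP => hu.
  have pu : root p u by rewrite rootE Eh hornerM hu mul0r.
  have : u \in s by rewrite in_roots pu p0 in_itv/= zu ub.
  rewrite -root_prod_XsubC => /eqP su.
  have : p^`().[u] != 0 by apply: simple => //; rewrite in_itv/= zu.
  by rewrite Eh derivM hornerD !hornerM hu su mul0r mulr0 addr0 eqxx.
have hh : 0 < h.[z] * h.[b].
  rewrite lt0r mulf_neq0 ?h0 ?lexx ?(ltW zb)//=.
  rewrite leNgt; apply/negP => /(poly_ivtoo (ltW zb)) [u].
  by rewrite in_itv/= => /andP[zu ub]; apply/negP/h0; rewrite !ltW.
have prod_sign (t : seq R) : {in t, forall u, z < u < b} ->
    0 < (-1) ^+ size t * (\prod_(u <- t) ('X - u%:P)).[z] /\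
    0 < (\prod_(u <- t) ('X - u%:P)).[b].
  elim: t => [_|u t IH tzb]; first by rewrite big_nil !hornerE.
  have /andP[zu ub] := tzb _ (mem_head _ _).
  have [|IH1 IH2] := IH; first by move=> v vt; apply: tzb; rewrite inE vt orbT.
  rewrite big_cons !hornerM !hornerXsubC exprS; split.
    rewrite mulrACA mulr_gt0// mulN1r oppr_gt0 subr_lt0//.
  by rewrite mulr_gt0// subr_gt0.
have [|p1 p2] := prod_sign s.
  by move=> u /roots_in; rewrite in_itv.
have hb : 0 < h.[b] by move: pb; rewrite Eh hornerM pmulr_lgt0.
have hz : 0 < h.[z] by move: hh; rewrite pmulr_lgt0.
set e := (-1) ^+ _.
have e1 : e * e = 1 by rewrite /e -expr2 sqrr_sign.
have ep : 0 < e * p.[z] by rewrite Eh hornerM mulrCA mulr_gt0.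
have -> : `|p.[z]| = e * p.[z].
  rewrite -[RHS]ger0_norm ?ltW// normrM /e normrX normrN1 expr1n mul1r //.
by rewrite mulrA e1 mul1r.
Qed.

End sturm.

(** * Winding of perturbed third-order recurrences *)

Section angles.
Variable R : realType.
Implicit Types (x y t e : R).

Lemma norm_atan_le x : `|atan x| <= `|x|.
Proof.
suff H y : 0 <= y -> 0 <= atan y <= y.
  have [x0|x0] := leP 0 x.
    by have /andP[? ?] := H x x0; rewrite !ger0_norm.
  have /andP[] : 0 <= atan (- x) <= - x by apply: H; rewrite oppr_ge0 ltW.
  by rewrite atanN oppr_ge0 lerN2 => a0 ax; rewrite !ler0_norm ?lerN2 // ltW.
rewrite le_eqVlt => /predU1P[<-|y0]; first by rewrite atan0 !lexx.
have [|c _] := @MVT R (@atan R) (fun u => (1 + u ^+ 2)^-1) 0 y y0.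
  by apply: continuous_subspaceT => u; exact: continuous_atan.
rewrite atan0 !subr0 => ->; have c2 := sqr_ge0 c.
have c1 : 1 <= 1 + c ^+ 2 by rewrite lerDl.
have cp : 0 < 1 + c ^+ 2 by apply: lt_le_trans c1.
apply/andP; split; first by apply: mulr_ge0; rewrite ?invr_ge0 ltW.
by apply: ler_piMl; [exact: ltW|rewrite invf_le1].
Qed.

Lemma polar_upper x y : 0 < y ->
  exists rho t, [/\ 0 < rho, 0 < t < pi, x = rho * cos t & y = rho * sin t].
Proof.
move=> y0; pose rho := Num.sqrt (x ^+ 2 + y ^+ 2).
have s0 : 0 < x ^+ 2 + y ^+ 2 by have := sqr_ge0 x; nra.
have rho0 : 0 < rho by rewrite sqrtr_gt0.
have rho2 : rho ^+ 2 = x ^+ 2 + y ^+ 2 by rewrite sqr_sqrtr ?ltW.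
have xr : -1 < x / rho < 1.
  by rewrite ltr_pdivlMr// ltr_pdivrMr//; apply/andP; split; nra.
have xr' : -1 <= x / rho <= 1 by case/andP: xr => ? ?; rewrite !ltW.
exists rho, (acos (x / rho)); split => //.
- case/andP: xr => ? ?; rewrite acos_gt0 ?acos_ltpi//; apply/andP;
  by split => //; rewrite ltW.
- by rewrite acosK// mulrC divfK// gt_eqF.
- rewrite sin_acos//; have -> : 1 - (x / rho) ^+ 2 = (y / rho) ^+ 2.
    have E : y ^+ 2 = rho ^+ 2 - x ^+ 2 by rewrite rho2; ring.
    by rewrite !expr_div_n E; field; rewrite gt_eqF.
  by rewrite sqrtr_sqr ger0_norm ?divr_ge0 ?ltW// mulrC divfK// gt_eqF.
Qed.

Lemma sinDnpi t n : sin (t + n%:R * pi) = (-1) ^+ n * sin t.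
Proof. by rewrite mulr_natl (alternatingn (@sinDpi R)). Qed.

Lemma cosDnpi t n : cos (t + n%:R * pi) = (-1) ^+ n * cos t.
Proof. by rewrite mulr_natl (alternatingn (@cosDpi R)). Qed.

(** The window covers three half-turns, and the sine has the prescribed sign only inside the middle
    one. *)
Lemma sin_branch n t : 0 < (-1) ^+ n * sin t -> (n%:R - 1) * pi < t < (n%:R + 2) * pi ->
  n%:R * pi < t < (n%:R + 1) * pi.
Proof.
have pi0 := pi_gt0 R.
rewrite -[t](subrK (n%:R * pi)); set u := t - _.
rewrite sinDnpi mulrA -expr2 sqrr_sign mul1r => su /andP[t1 t2].
have u1 : - pi < u by lra.
have u2 : u < pi + pi by lra.
suff /andP[? ?] : 0 < u < pi by apply/andP; split; lra.
apply/andP; split; rewrite ltNge; apply/negP => h.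
  have : 0 <= sin (- u) by apply: sin_ge0_pi; lra.
  by rewrite sinN oppr_ge0 leNgt su.
have : 0 <= sin (u - pi) by apply: sin_ge0_pi; lra.
by rewrite sinB cospi sinpi mulr0 subr0 mulrN1 oppr_ge0 leNgt su.
Qed.

(** In the frame turned by [eta + phi] the new vector has coordinates [A] and [B], with A at least r
    rho / 2 and |B| at most e r rho; its residual angle is atan (B / A). *)
Lemma rotation_step r phi rho eta d e : 0 < r -> 0 < rho -> 0 <= e <= 2^-1 ->
  `|d| <= e * (r * rho) ->
  exists rho' dl, [/\ 0 < rho', `|dl| <= 2 * e,
    r * (cos phi * (rho * cos eta) - sin phi * (rho * sin eta)) + d =
      rho' * cos (eta + phi + dl) &
    r * (sin phi * (rho * cos eta) + cos phi * (rho * sin eta)) =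
      rho' * sin (eta + phi + dl)].
Proof.
move=> r0 rho0 /andP[e0 e2] de; set psi := eta + phi.
pose A := r * rho + d * cos psi; pose B := - (d * sin psi).
have rr0 : 0 < r * rho by rewrite mulr_gt0.
have dc : `|d * cos psi| <= e * (r * rho).
  by rewrite normrM (le_trans _ de)// ler_piMr// cos_max.
have ds : `|d * sin psi| <= e * (r * rho).
  by rewrite normrM (le_trans _ de)// ler_piMr// sin_max.
have A2 : (r * rho) / 2 <= A.
  by move: dc; rewrite /A ler_norml => /andP[? ?]; nra.
have A0 : 0 < A by apply: lt_le_trans A2; rewrite divr_gt0.
pose dl := atan (B / A).
have cdl : 0 < cos dl by apply: cos_gt0_pihalf; rewrite atan_gtNpi2 atan_ltpi2.
have sdl : A * sin dl = B * cos dl.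
  have := atanK (B / A); rewrite -/dl /tan => /(congr1 (fun u => u * cos dl * A)).
  by rewrite divfK ?gt_eqF// mulrAC divfK ?gt_eqF// mulrC.
have sdlE : sin dl = B * cos dl / A by rewrite -sdl mulrC mulKf // gt_eqF.
have c2 := cos2Dsin2 psi.
exists (A / cos dl), dl; split.
- exact: divr_gt0.
- rewrite (le_trans (norm_atan_le _))// normrM normfV (gtr0_norm A0).
  rewrite ler_pdivrMr// /B normrN (le_trans ds)//.
  have : e * (r * rho) <= e * (2 * A) by apply: ler_wpM2l => //; lra.
  by lra.
- rewrite cosD sdlE.
  have -> : r * (cos phi * (rho * cos eta) - sin phi * (rho * sin eta)) =
      r * rho * cos psi.
    by rewrite cosD; ring.
  have -> : d = d * (cos psi ^+ 2 + sin psi ^+ 2) by rewrite c2 mulr1.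
  rewrite /B /A; field; rewrite ?gt_eqF//.
- rewrite sinD sdlE.
  have -> : r * (sin phi * (rho * cos eta) + cos phi * (rho * sin eta)) =
      r * rho * sin psi.
    by rewrite sinD; ring.
  rewrite /B /A; field; rewrite ?gt_eqF//.
Qed.

End angles.

Section winding.
Variables (R : realType) (k : R) (y : nat -> R) (N : nat -> nat).
Hypothesis k3 : 1 / 3 < k.
Hypothesis N1 : forall m, (N m <= N m.+1 <= (N m).+1)%N.
Hypothesis N2 : forall m, (N m.+2 <= (N m).+1)%N.
Hypothesis sgn : forall m, y m = (-1) ^+ N m * `|y m|.
Hypothesis nz : forall m, y m != 0 \/ y m.+1 != 0.
Hypothesis rec : forall e : R, 0 < e -> exists M, forall m, (M <= m)%N ->
  `|y m.+3 - y m.+2 + k ^+ 2 * (1 + k) * y m| <= e * (`|y m.+2| + `|y m|).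

Let q := Num.sqrt (1 + k^-1).
Let r := k * q.
Let phi := acos (q / 2).
Let co := cos phi.
Let si := sin phi.

Let k0 : 0 < k. Proof. by move: k3; lra. Qed.

Let q2 : q ^+ 2 = 1 + k^-1.
Proof. by rewrite sqr_sqrtr// addr_ge0// invr_ge0 ltW. Qed.

Let q_gt0 : 0 < q.
Proof. by rewrite sqrtr_gt0 addr_gt0// invr_gt0. Qed.

Let q_lt2 : q / 2 < 1.
Proof.
rewrite ltr_pdivrMr// mul1r -(ltr_pXn2r (n := 2)) ?nnegrE ?ltW// q2.
have : k^-1 < 3 by rewrite invf_plt ?posrE//; move: k3; lra.
by lra.
Qed.

Let qI : -1 <= q / 2 <= 1. Proof. by have := q_gt0; have := q_lt2; lra. Qed.

Let coE : co = q / 2. Proof. by rewrite /co acosK. Qed.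

Let si_gt0 : 0 < si.
Proof.
rewrite /si sin_acos// sqrtr_gt0 subr_gt0 expr_lt1//.
by rewrite divr_ge0 // ltW.
Qed.

Let r_gt0 : 0 < r. Proof. exact: mulr_gt0. Qed.

Let r2 : r ^+ 2 = k * (1 + k).
Proof. by rewrite /r exprMn q2; field; rewrite gt_eqF. Qed.

Let rco : 2 * (r * co) = 1 + k.
Proof.
rewrite coE /r -[RHS](_ : k * q ^+ 2 = _); first by field.
by rewrite q2; field; rewrite gt_eqF.
Qed.

Let phi_gt0 : 0 < phi.
Proof. by apply: acos_gt0; case/andP: qI => -> _. Qed.

Let phi_lt : phi < pi / 2.
Proof.
have := @acos_lepi R _ qI; have := @acos_ge0 R _ qI; rewrite -/phi => p0 p1.
have pi0 := pi_gt0 R.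
rewrite -(@ltr_cos R) ?cos_pihalf ?in_itv/= ?p0 ?p1//; last by lra.
by rewrite -/co coE divr_gt0.
Qed.

(* The limiting recurrence has the characteristic roots - k and
   l = r (co +- i si). [w] kills the mode (- k)^m, and [X m + i Y m] is
   w_(m+1) - conj(l) w_m, which the limiting recurrence multiplies by l. *)
Let w m := y m.+1 + k * y m.
Let X m := w m.+1 - r * co * w m.
Let Y m := r * si * w m.
Let err m := y m.+3 - y m.+2 + k ^+ 2 * (1 + k) * y m.

(** Removing the mode - k leaves w_(m+2) = (1 + k) w_(m+1) - k (1 + k) w_m + err_m, so only the
    first coordinate of the rotation is perturbed. *)
Let Xrec m : X m.+1 = r * (co * X m - si * Y m) + err m.
Proof.
have cs : co ^+ 2 + si ^+ 2 = 1 by exact: cos2Dsin2.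
have -> : r * (co * X m - si * Y m) =
  r * co * w m.+1 - r ^+ 2 * (co ^+ 2 + si ^+ 2) * w m by rewrite /X /Y; ring.
rewrite cs mulr1 r2 /X.
have -> : r * co = (1 + k) / 2 by rewrite -rco; field.
by rewrite /w /err; field.
Qed.

Let Yrec m : Y m.+1 = r * (si * X m + co * Y m).
Proof. by rewrite /X /Y; ring. Qed.

(** At such an index y_m and y_(m+1) carry the same sign (-1)^(N m), so nothing cancels in [w m]: it
    bounds both of them and gives [Y m] a known sign. *)
Let good m := N m.+1 == N m.

Let stepN m : N m.+1 = (N m + ~~ good m)%N.
Proof.
rewrite /good; have := N1 m; rewrite leq_eqVlt => /andP[/predU1P[->|]].
  by rewrite eqxx addn0.
move=> h1 h2; rewrite gtn_eqF//= addn1; apply/eqP.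
by rewrite eqn_leq h2.
Qed.

Let good_next m : ~~ good m -> good m.+1.
Proof.
move=> g; have := N2 m; rewrite stepN (stepN m) g addn1.
case: (good m.+1) => //=.
by rewrite addn1 ltnn.
Qed.

Let good_norm m : good m -> (-1) ^+ N m * w m = `|y m.+1| + k * `|y m|.
Proof.
move=> /eqP g; rewrite /w {1}(sgn m.+1) {1}(sgn m) g.
set s := (-1) ^+ _; have ss : s * s = 1 by rewrite /s -expr2 sqrr_sign.
rewrite -[RHS]mul1r -ss; ring.
Qed.

Let norm_good_w m : good m -> `|w m| = `|y m.+1| + k * `|y m|.
Proof.
move=> g; rewrite -good_norm// -[LHS]mul1r -[in LHS](normr_sign R (N m)).
by rewrite -normrM ger0_norm // good_norm// addr_ge0// mulr_ge0// ltW.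
Qed.

Let good_pos m : good m -> 0 < (-1) ^+ N m * Y m.
Proof.
move=> g; rewrite /Y mulrCA good_norm// mulr_gt0//; first exact: mulr_gt0.
have [h|h] := nz m.
  by rewrite ltr_wpDl// mulr_gt0// normr_gt0.
by rewrite ltr_pwDl// ?normr_gt0// mulr_ge0// ltW.
Qed.

(** [D] comes from solving w_m = Y_m / (r si) and w_(m+1) = X_m + r co w_m; [K] adds up the factors
    met in recovering y from w in both cases of [y_bound]. *)
Let D := 1 + (1 + r * co) / (r * si).
Let K := D * (1 + k + k^-1 + k^-1 * k^-1).

Let co_gt0 : 0 < co. Proof. by rewrite coE divr_gt0. Qed.

Let D_ge1 : 1 <= D.
Proof.
rewrite lerDl divr_ge0 ?mulr_ge0 ?addr_ge0 ?mulr_ge0//;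
by move: si_gt0 co_gt0 r_gt0 => *; apply/ltW.
Qed.

Let K_gt0 : 0 < K.
Proof.
have j0 : 0 < k^-1 by rewrite invr_gt0.
apply: mulr_gt0; first exact: lt_le_trans D_ge1.
by rewrite !addr_gt0// mulr_gt0.
Qed.

Let w_bound m rho : `|X m| <= rho -> `|Y m| <= rho ->
  `|w m| <= D * rho /\ `|w m.+1| <= D * rho.
Proof.
move=> Xr Yr; have rs : 0 < r * si by exact: mulr_gt0.
have rc : 0 < r * co by exact: mulr_gt0.
have rho0 : 0 <= rho by apply: le_trans Xr.
have w0 : `|w m| <= rho / (r * si).
  rewrite ler_pdivlMr// -[X in _ * X <= _](gtr0_norm rs) -normrM mulrC.
  by rewrite -/(Y m).
have D0 : D * rho = rho + rho / (r * si) + r * co * (rho / (r * si)).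
  by rewrite /D; field; rewrite !gt_eqF.
have p0 : 0 <= rho / (r * si) by rewrite divr_ge0// ltW.
split.
  rewrite (le_trans w0)// D0 addrAC lerDr addr_ge0// mulr_ge0// ltW//.
rewrite D0; have -> : w m.+1 = X m + r * co * w m by rewrite /X subrK.
rewrite (le_trans (ler_normD _ _))// normrM (gtr0_norm rc).
have : r * co * `|w m| <= r * co * (rho / (r * si)) by rewrite ler_wpM2l// ltW.
by move: Xr p0; lra.
Qed.

(* This fails for y_m = (- k)^m, where [w] vanishes; that mode is excluded
   because the sign does not change twice in a row. *)
Let y_bound m rho : `|X m| <= rho -> `|Y m| <= rho ->
  `|y m| <= K * rho /\ `|y m.+2| <= K * rho.
Proof.
move=> Xr Yr; have [w0 w1] := w_bound Xr Yr.
pose j := k^-1; have j0 : 0 < j by rewrite invr_gt0.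
have jk : j * k = 1 by rewrite /j mulVf// gt_eqF.
set E := D * rho in w0 w1.
have E0 : 0 <= E by apply: le_trans w0.
have KE : K * rho = E + k * E + j * E + j * (j * E).
  by rewrite /K /E /j; ring.
have kE : 0 <= k * E by rewrite mulr_ge0// ltW.
have jE : 0 <= j * E by rewrite mulr_ge0// ltW.
have jjE : 0 <= j * (j * E) by rewrite mulr_ge0// ltW.
have scale a b : k * a <= b -> a <= j * b.
  move=> ab; have : j * (k * a) <= j * b by rewrite ler_wpM2l// ltW.
  by rewrite mulrA jk mul1r.
(* If m is good, w_m bounds y_m and y_(m+1), and w_(m+1) then yields y_(m+2). Otherwise m + 1 is
   good: w_(m+1) bounds y_(m+1) and y_(m+2), and w_m then yields y_m. *)
rewrite KE; have [g|/good_next g] := boolP (good m).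
  move: w0; rewrite norm_good_w// => w0.
  have y1 : `|y m.+1| <= E.
    by have := mulr_ge0 (ltW k0) (normr_ge0 (y m)); move: w0; lra.
  have y0 : `|y m| <= j * E.
    by apply: scale; have := normr_ge0 (y m.+1); move: w0; lra.
  split; first by move: y0; lra.
  have -> : y m.+2 = w m.+1 - k * y m.+1 by rewrite /w; ring.
  rewrite (le_trans (ler_normB _ _))// normrM (gtr0_norm k0).
  have : k * `|y m.+1| <= k * E by rewrite ler_wpM2l// ltW.
  by move: w1; lra.
move: w1; rewrite norm_good_w// => w1.
have y2 : `|y m.+2| <= E.
  by have := mulr_ge0 (ltW k0) (normr_ge0 (y m.+1)); move: w1; lra.
have y1 : `|y m.+1| <= j * E.
  by apply: scale; have := normr_ge0 (y m.+2); move: w1; lra.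
split; last by move: y2; lra.
have y0 : `|y m| <= j * (E + j * E).
  apply: scale; have -> : k * `|y m| = `|w m - y m.+1|.
    by rewrite /w addrAC subrr add0r normrM gtr0_norm.
  by rewrite (le_trans (ler_normB _ _))// lerD.
by move: y0; rewrite mulrDr; lra.
Qed.

(** As |y_(m+2)| + |y_m| is at most 2 K rho, the tolerance e r / (4 K) makes the perturbation at
    most (e / 2) r rho, hence an angular error of at most e. *)
Let arg_step m rho eta e : 0 < e <= 1 -> 0 < rho ->
  `|err m| <= e * r / (4 * K) * (`|y m.+2| + `|y m|) ->
  X m = rho * cos eta -> Y m = rho * sin eta ->
  exists rho' dl, [/\ 0 < rho', `|dl| <= e,
    X m.+1 = rho' * cos (eta + phi + dl) & Y m.+1 = rho' * sin (eta + phi + dl)].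
Proof.
move=> /andP[e0 e1] rho0 ee Xe Ye.
have le_rho c : `|c| <= 1 -> `|rho * c| <= rho.
  by move=> c1; rewrite normrM gtr0_norm// ler_piMr// ltW.
have [y0 y2] : `|y m| <= K * rho /\ `|y m.+2| <= K * rho.
  by apply: y_bound; rewrite ?Xe ?Ye le_rho ?cos_max ?sin_max.
have e2 : 0 <= e / 2 <= 2^-1 by lra.
have [|rho' [dl [rho'0 dle Xs Ys]]] :=
    @rotation_step R r phi rho eta (err m) (e / 2) r_gt0 rho0 e2.
  apply: le_trans ee _.
  have -> : e / 2 * (r * rho) = e * r / (4 * K) * (K * rho + K * rho).
    by field; rewrite gt_eqF.
  apply: ler_wpM2l; last by rewrite lerD.
  by apply/ltW/divr_gt0; apply: mulr_gt0.
exists rho', dl; split => //.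
- by move: dle; lra.
- by rewrite Xrec Xe Ye.
- by rewrite Yrec Xe Ye.
Qed.

(** The lifted argument eta of (X, Y) is compared both with m phi, by adding the steps, and with N_m
    pi, by the sign of Y. The conditions on e keep each turn strictly between 0 and pi / 2. *)
Let winding_bound e : 0 < e -> e <= 1 -> e < phi -> e < pi / 2 - phi ->
  exists M C, forall m, (M <= m)%N ->
    `|(N m)%:R * pi - m%:R * phi| <= C + m%:R * e.
Proof.
move=> e0 e1 ephi epi; have pi0 := pi_gt0 R.
have [|M HM] := rec (e := e * r / (4 * K)).
  by apply: divr_gt0; apply: mulr_gt0.
have [M0 MM0 gM0] : exists2 M0, (M <= M0)%N & good M0.
  have [g|/good_next g] := boolP (good M); first by exists M.
  by exists M.+1.
have [rho0 [t [rho00 t0 X0 Y0]]] := polar_upper ((-1) ^+ N M0 * X M0) (good_pos gM0).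
(* The sign (-1)^(N M0) moved the vector into the upper half-plane; adding [N M0] half-turns undoes
   this and picks the lift lying in the half-turn of that number. *)
pose eta0 := t + (N M0)%:R * pi.
(* The sign of [Y m], hence the half-turn containing [eta], is known only at good
   m; a bad m follows a good one and [eta] overshoots by at most a quarter. *)
suff H n : exists rho eta, [/\ 0 < rho,
    X (M0 + n)%N = rho * cos eta, Y (M0 + n)%N = rho * sin eta,
    `|eta - eta0 - n%:R * phi| <= n%:R * e &
    (N (M0 + n))%:R * pi < eta <
      (N (M0 + n))%:R * pi + pi + (~~ good (M0 + n))%:R * (pi / 2)].
  exists M0, (`|eta0| + M0%:R * phi + 2 * pi) => m Mm.
  have [rho [eta [_ _ _]]] := H (m - M0)%N.
  rewrite subnKC// => + /andP[h1 h2].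
  rewrite natrB// => h.
  have b1 : (~~ good m)%:R * (pi / 2) <= pi / 2 :> R.
    by case: (good m) => /=; lra.
  have h0 : 0 <= M0%:R * phi by rewrite mulr_ge0// ltW.
  have h0' : 0 <= M0%:R * e by rewrite mulr_ge0// ltW.
  have := ler_norm eta0; have := ler_norm (- eta0); rewrite normrN.
  move: h; rewrite !ler_norml => /andP[h3 h4] h5 h6.
  by apply/andP; split; lra.
elim: n => [|n [rho [eta [rho_gt0 Xe Ye ee /andP[l u]]]]].
  have ss : (-1) ^+ N M0 * (-1) ^+ N M0 = 1 :> R by rewrite -expr2 sqrr_sign.
  exists rho0, eta0; rewrite addn0 gM0; split => //.
  - by rewrite /eta0 cosDnpi mulrCA -X0 mulrA ss mul1r.
  - by rewrite /eta0 sinDnpi mulrCA -Y0 mulrA ss mul1r.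
  - by rewrite subrr sub0r !mul0r normrN normr0.
  - by case/andP: t0 => ? ?; rewrite /eta0 /=; lra.
set m := (M0 + n)%N in Xe Ye l u *.
have e01 : 0 < e <= 1 by rewrite e0.
have [|rho' [dl [rho'0 dle X' Y']]] := @arg_step m rho eta e e01 rho_gt0 _ Xe Ye.
  by apply: HM; rewrite (leq_trans MM0)// leq_addr.
exists rho', (eta + phi + dl); rewrite addnS -/m; split => //.
  rewrite -!natr1.
  have -> : eta + phi + dl - eta0 - (n%:R + 1) * phi =
    (eta - eta0 - n%:R * phi) + dl by ring.
  by rewrite (le_trans (ler_normD _ _))// mulrDl mul1r lerD.
move: dle; rewrite ler_norml => /andP[d1 d2].
have [g|g] := boolP (good m.+1); last first.
  have g' : good m by apply: contraNT g => /good_next.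
  move: l u; rewrite stepN g' /= addn0 mul0r => l u; lra.
have sY : 0 < (-1) ^+ N m.+1 * sin (eta + phi + dl).
  by have := good_pos g; rewrite Y' mulrCA pmulr_rgt0.
rewrite mul0r addr0 -[X in _ * pi + X]mul1r -mulrDl; apply: sin_branch => //.
move: l u; rewrite stepN natrD; case: (good m) => /= l u; lra.
Qed.

Lemma winding_cvg : (N m)%:R / m%:R @[m --> \oo] --> phi / pi.
Proof.
have pi0 := pi_gt0 R.
apply/cvgrPdist_le => eps eps0.
pose e := Num.min (Num.min 1 (phi / 2)) (Num.min ((pi / 2 - phi) / 2) (eps / 2)).
have p2 : 0 < pi / 2 - phi by rewrite subr_gt0.
have e0 : 0 < e by rewrite !lt_min ltr01 !divr_gt0.
have [e1 ephi epi eeps] : [/\ e <= 1, e < phi, e < pi / 2 - phi & e <= eps / 2].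
  split.
  - by rewrite !ge_min lexx.
  - by rewrite !gt_min; apply/orP; left; apply/orP; right; move: phi_gt0; lra.
  - by rewrite !gt_min; apply/orP; right; apply/orP; left; lra.
  - by rewrite !ge_min lexx !orbT.
have [M [C MC]] := winding_bound e0 e1 ephi epi.
near=> m.
have m0 : 0 < m%:R :> R by rewrite ltr0n; near: m; exact: nbhs_infty_gt.
have Mm : (M <= m)%N by near: m; exact: nbhs_infty_ge.
have Cm : C / (eps / 2) <= m%:R by near: m; exact: nbhs_infty_ger.
rewrite distrC; have -> : (N m)%:R / m%:R - phi / pi =
    ((N m)%:R * pi - m%:R * phi) / (m%:R * pi).
  by move: (pi : R) pi0 => p p0; field; rewrite (gt_eqF p0) (gt_eqF m0).
rewrite normrM normfV (gtr0_norm (mulr_gt0 m0 pi0)) ler_pdivrMr ?mulr_gt0//.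
apply: le_trans (MC _ Mm) _.
move: Cm; rewrite ler_pdivrMr ?divr_gt0// => Cm.
have me : m%:R * e <= m%:R * (eps / 2) by rewrite ler_wpM2l// ltW.
have pi1 : 1 <= pi :> R by apply: le_trans (pi_ge2 R); lra.
have : eps * m%:R <= eps * m%:R * pi by rewrite ler_peMr// mulr_ge0// ltW.
by move: Cm me; lra.
Unshelve. all: by end_near. Qed.

End winding.

(** * Power series and the generating function *)

Section power_series.
Variable R : realType.
Implicit Types (c : nat -> R) (x t l : R).

Lemma ler_pow_secant (a b : R) n : 0 <= a <= b ->
  n.+1%:R * a ^+ n * (b - a) <= b ^+ n.+1 - a ^+ n.+1.
Proof.
move=> /andP[a0 ab]; elim: n => [|n IH]; first by rewrite !expr1 expr0; lra.
have an : 0 <= a ^+ n.+1 * (b - a) by rewrite mulr_ge0 ?exprn_ge0// subr_ge0.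
have -> : b ^+ n.+2 - a ^+ n.+2 = b * (b ^+ n.+1 - a ^+ n.+1) + a ^+ n.+1 * (b - a).
  by rewrite !exprS; ring.
have -> : n.+2%:R * a ^+ n.+1 * (b - a) =
    a * (n.+1%:R * a ^+ n * (b - a)) + a ^+ n.+1 * (b - a).
  by rewrite -natr1 exprS; ring.
rewrite lerD2r; apply: le_trans (ler_wpM2l a0 IH) _.
by rewrite ler_wpM2r// subr_ge0 lerXn2r// ?nnegrE// (le_trans a0).
Qed.

(** For y strictly between |x| and |K|, convexity of the power gives (n+1) |x|^n <= y^(n+1) / (y -
    |x|), so the absolutely convergent series at y dominates. *)
Lemma is_cvg_pseries_diffs c K x : cvgn (pseries c K) -> `|x| < `|K| ->
  cvgn (pseries (pseries_diffs c) x).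
Proof.
move=> cK xK; pose y := (`|x| + `|K|) / 2.
have xy : `|x| < y by rewrite /y; lra.
have yK : `|y| < `|K| by rewrite ger0_norm /y; have := normr_ge0 x; lra.
have /cvg_ex[/= l cl] := is_cvg_pseries_inside_norm cK yK.
have y0 : 0 <= y by apply: le_trans (ltW xy).
apply: normed_cvg.
apply: (@series_le_cvg _ _ (fun n => (y - `|x|)^-1 * (`|c n.+1| * y ^+ n.+1))) => //.
- by move=> n; exact: normr_ge0.
- move=> n /=;  rewrite !mulr_ge0 ?exprn_ge0//.
  by rewrite invr_ge0 subr_ge0 ltW.
- move=> n /=; rewrite /pseries_diffs !normrM normrX normr_nat.
  rewrite [leRHS]mulrC ler_pdivlMr ?subr_gt0//.
  have := @ler_pow_secant `|x| y n; rewrite normr_ge0 ltW// => /(_ isT) h.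
  have xn : 0 <= `|x| ^+ n.+1 by rewrite exprn_ge0.
  have -> : n.+1%:R * `|c n.+1| * `|x| ^+ n * (y - `|x|) =
    `|c n.+1| * (n.+1%:R * `|x| ^+ n * (y - `|x|)) by ring.
  by rewrite ler_wpM2l//; lra.
- apply: is_cvg_seriesZ.
  apply/cvg_ex; exists (l - `|c 0%N|).
  rewrite -(cvg_shiftS (pseries (fun i => `|c i|) y)) in cl.
  have -> : series (fun n => `|c n.+1| * y ^+ n.+1) =
     (fun n => pseries (fun i => `|c i|) y n.+1 - `|c 0%N|).
    apply/funext => n; rewrite /pseries /series /= big_nat_recl//= expr0 mulr1.
    by rewrite addrC addKr.
  by apply: cvgB => //; exact: cvg_cst.
Qed.

Lemma is_derive_pseries c K x : cvgn (pseries c K) -> `|x| < `|K| ->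
  is_derive x 1 (fun x => limn (pseries c x)) (limn (pseries (pseries_diffs c) x)).
Proof.
move=> cK xK.
(* Each termwise differentiation costs a strict decrease of the radius, and [pseries_snd_diffs]
   involves two of them, beyond |x|; hence two intermediate radii. *)
pose y := (`|x| + `|K|) / 2; pose u := (y + `|K|) / 2.
have x0 := normr_ge0 x.
have y0 : 0 <= y by rewrite /y; lra.
have u0 : 0 <= u by rewrite /u; lra.
have xy : `|x| < `|y| by rewrite (ger0_norm y0) /y; lra.
have yu : `|y| < `|u| by rewrite (ger0_norm y0) (ger0_norm u0) /u /y; lra.
have uK : `|u| < `|K| by rewrite (ger0_norm u0) /u /y; lra.
have c1 := is_cvg_pseries_diffs cK uK.
apply: (@pseries_snd_diffs _ c y) => //.
- exact: is_cvg_pseries_inside cK (lt_trans yu uK).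
- exact: is_cvg_pseries_inside c1 yu.
- exact: is_cvg_pseries_diffs c1 yu.
Qed.

Lemma near_pseries_diffs c (f df : R -> R) :
  (\forall t \near (0 : R), pseries c t @ \oo --> f t) ->
  (\forall t \near (0 : R), is_derive (t : R) (1 : R) f (df t)) ->
  \forall t \near (0 : R), pseries (pseries_diffs c) t @ \oo --> df t.
Proof.
move=> /nbhs_ballP[d d0 cf] dfn.
have hd : 0 < d / 2 by rewrite divr_gt0.
have cd : cvgn (pseries c (d / 2)).
  apply/cvg_ex; exists (f (d / 2)); apply: cf.
  by rewrite /ball/= sub0r normrN gtr0_norm//; lra.
have small : \forall t \near (0 : R), `|t| < d / 2.
  apply/nbhs_ballP; exists (d / 2) => //= t.
  by rewrite /ball/= sub0r normrN.
near=> t.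
have td : `|t| < d / 2 by near: t.
have tK : `|t| < `|d / 2| by rewrite (gtr0_norm hd).
have cdt := is_cvg_pseries_diffs cd tK.
have dp := is_derive_pseries cd tK.
have dft : is_derive t 1 f (df t) by near: t.
suff -> : df t = limn (pseries (pseries_diffs c) t) by [].
rewrite -(@derive_val _ _ _ _ _ _ _ dft) -(@derive_val _ _ _ _ _ _ _ dp).
apply: near_eq_derive.
near=> s.
apply/esym/cvg_lim => //; apply: cf.
rewrite /ball/= sub0r normrN.
have st : `|s - t| < d / 2.
  near: s; apply/nbhs_ballP; exists (d / 2) => //= s.
  by rewrite /ball/= distrC.
 have := ler_normD (s - t) t; rewrite subrK; lra.
Unshelve. all: by end_near. Qed.

(** At t = 0 the sum is c_0; the other coefficients follow by induction through the differentiated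
    series. *)
Lemma pseries_eq0 c : (\forall t \near (0 : R), pseries c t @ \oo --> (0 : R)) ->
  forall n, c n = 0.
Proof.
move=> + n; elim: n c => [|n IH] c c0.
  have := nbhs_singleton c0; rewrite -cvg_shiftS => h.
  have {h} : (fun=> c 0%N) @ \oo --> (0 : R).
    apply: cvg_trans h; apply: near_eq_cvg; near=> m.
    rewrite /pseries /series /= big_nat_recl//= expr0 mulr1 big1 ?addr0// => i _.
    by rewrite expr0n/= mulr0.
  by move=> /(cvg_lim (@Rhausdorff R)); rewrite lim_cst.
have /IH : \forall t \near (0 : R), pseries (pseries_diffs c) t @ \oo --> (0 : R).
  apply: (@near_pseries_diffs c (fun=> 0) (fun=> 0)) => //.
  by near=> t; exact: is_derive_cst.
by rewrite /pseries_diffs => /eqP; rewrite mulf_eq0 pnatr_eq0/= => /eqP.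
Unshelve. all: by end_near. Qed.

Definition pseries_shift c n : R := if n is k.+1 then c k else 0.

Lemma cvg_pseries_shift c t l : pseries c t @ \oo --> l ->
  pseries (pseries_shift c) t @ \oo --> t * l.
Proof.
move=> cl; rewrite -cvg_shiftS.
have -> : (fun n => pseries (pseries_shift c) t n.+1) = (fun n => t * pseries c t n).
  apply/funext => n; rewrite /pseries /series /= big_nat_recl//= mul0r add0r.
  by rewrite mulr_sumr; apply: eq_bigr => i _; rewrite exprS; ring.
by apply: cvgMr.
Qed.

Lemma cvg_pseriesD c d t l m : pseries c t @ \oo --> l -> pseries d t @ \oo --> m ->
  pseries (fun n => c n + d n) t @ \oo --> l + m.
Proof.
move=> cl dm; have -> : pseries (fun n => c n + d n) t = pseries c t \+ pseries d t.
  apply/funext => n; rewrite /pseries /series /= -big_split/=.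
  by apply: eq_bigr => i _; rewrite mulrDl.
exact: cvgD.
Qed.

Lemma cvg_pseriesZ a c t l : pseries c t @ \oo --> l ->
  pseries (fun n => a * c n) t @ \oo --> a * l.
Proof.
move=> cl; have -> : pseries (fun n => a * c n) t = (fun n => a * pseries c t n).
  apply/funext => n; rewrite /pseries /series /= mulr_sumr.
  by apply: eq_bigr => i _; rewrite mulrA.
exact: cvgMr.
Qed.

End power_series.

Section generating_function.
Variable R : realType.

Lemma generated_coef_rec (alpha z : R) (c : nat -> R) :
  (\forall t \near (0 : R), series (fun m => c m * t ^+ m) @ \oo -->
      ((1 + t + z * t ^+ 3) `^ alpha)^-1) ->
  [/\ c 0%N = 1, c 1%N = - alpha, c 2%N = alpha * (1 + alpha) / 2 &
   forall m, m.+3%:R * c m.+3 =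
     - ((m.+2%:R + alpha) * c m.+2 + z * ((m%:R + 3 * alpha) * c m))].
Proof.
move=> cF; pose u (t : R) := 1 + t + z * t ^+ 3.
pose F (t : R) := u t `^ (- alpha).
pose dF (t : R) := - alpha * u t `^ (- alpha - 1) * (1 + 3 * z * t ^+ 2).
have u1 : \forall t \near (0 : R), 0 < u t.
  have uc : {for 0, continuous u}.
    apply: continuousD; first by apply: continuousD; [exact: cvg_cst|exact: cvg_id].
    by apply: continuousM; [exact: cvg_cst|exact: exprn_continuous].
  have u0 : 0 < u 0 by rewrite /u expr0n/= mulr0 !addr0.
  by move/cvgr_gt: uc => /(_ 0 u0).
have cF' : \forall t \near (0 : R), pseries c t @ \oo --> F t.
  by near=> t; rewrite /F powRN; near: t.
have dFn : \forall t \near (0 : R), is_derive (t : R) (1 : R) F (dF t).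
  near=> t.
  have ut : 0 < u t by near: t.
  have du : is_derive t (1 : R) u (1 + 3 * z * t ^+ 2).
    apply: is_derive_eq.
    rewrite /GRing.scale /=; ring.
  have dp := @is_derive1_powR _ (- alpha) _ ut.
  have := @is_derive1_comp _ (fun x => x `^ (- alpha)) u t _ _ dp du.
  by rewrite /dF mulrA.
have dc := near_pseries_diffs cF' dFn.
set c' := pseries_diffs c in dc.
pose sh := @pseries_shift R.
(* The coefficients of u F' + alpha u' F = 0. *)
pose d n := c' n + (sh c' n + (z * sh (sh (sh c')) n +
            (alpha * c n + 3 * alpha * z * sh (sh c) n))).
have d0 : forall n, d n = 0.
  apply: pseries_eq0; near=> t.
  have ut : 0 < u t by near: t.
  have cFt : pseries c t @ \oo --> F t by near: t.
  have dct : pseries c' t @ \oo --> dF t by near: t.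
  have -> : 0 = dF t + (t * dF t + (z * (t * (t * (t * dF t))) +
       (alpha * F t + 3 * alpha * z * (t * (t * F t))))) :> R.
    (* With F expressed through the power occurring in [dF], the differential equation becomes a
       polynomial identity. *)
    have FE : F t = u t * u t `^ (- alpha - 1).
      have := @powRD _ (u t) (- alpha - 1) 1; rewrite (gt_eqF ut) implybT.
      by move=> /(_ isT); rewrite subrK (powRr1 (ltW ut)) mulrC.
    by rewrite FE /dF /u; ring.
  apply: cvg_pseriesD => //; apply: cvg_pseriesD; first exact: cvg_pseries_shift.
  apply: cvg_pseriesD.
    by apply: cvg_pseriesZ; do 3!apply: cvg_pseries_shift.
  apply: cvg_pseriesD; first exact: cvg_pseriesZ.
  by apply: cvg_pseriesZ; do 2!apply: cvg_pseries_shift.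
have c0 : c 0%N = 1.
  have := nbhs_singleton cF'; rewrite /F /u expr0n/= mulr0 !addr0 powR1.
  rewrite -cvg_shiftS => h.
  have {h} : (fun=> c 0%N) @ \oo --> (1 : R).
    apply: cvg_trans h; apply: near_eq_cvg; near=> m.
    rewrite /pseries /series /= big_nat_recl//= expr0 mulr1 big1 ?addr0// => i _.
    by rewrite expr0n/= mulr0.
  by move=> /(cvg_lim (@Rhausdorff R)); rewrite lim_cst.
have c1 : c 1%N = - alpha.
  by have := d0 0%N; rewrite /d /sh /c' /pseries_diffs /= c0; lra.
have c2 : c 2%N = alpha * (1 + alpha) / 2.
  by have := d0 1%N; rewrite /d /sh /c' /pseries_diffs /= c1; lra.
(* For m = 0 the relevant equation is that of index 2, where the triple shift of [c'] takes its
   default value 0, in accordance with the factor m of c_m. *)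
split => // -[|m].
  by have := d0 2%N; rewrite /d /sh /c' /pseries_diffs /=; lra.
have := d0 m.+3; rewrite /d /sh /c' /pseries_diffs /= -!natr1 => E.
apply/eqP; rewrite -subr_eq0; apply/eqP; rewrite -[RHS]E; ring.
Unshelve. all: by end_near. Qed.

Lemma poly_ext (p q : {poly R}) : (forall z, p.[z] = q.[z]) -> p = q.
Proof.
move=> pq; apply/eqP; rewrite -subr_eq0; apply/eqP.
apply: (@roots_geq_poly_eq0 R _ [seq i%:R | i <- iota 0 (size (p - q))]).
- by apply/allP => x _; rewrite rootE hornerD hornerN pq subrr.
- rewrite map_inj_uniq ?iota_uniq// => i j /eqP.
  by rewrite eqr_nat => /eqP.
- by rewrite size_map size_iota.
Qed.

Variables (alpha : R) (P : nat -> {poly R}).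
Hypothesis alpha_gt0 : 0 < alpha.
Hypothesis HP : generated_by alpha P.

Definition pincherle_a m : R := (m.+2%:R + alpha) / m.+3%:R.
Definition pincherle_b m : R := (m%:R + 3 * alpha) / m.+3%:R.
(** The sign replaces t by - t, so that the generating function is a power of 1 - t - z t^3 and the
    recurrence has positive coefficients. *)
Definition pincherle m : {poly R} := (-1) ^+ m *: P m.

Lemma pincherle_init : [/\ pincherle 0 = 1%:P, pincherle 1 = alpha%:P &
  pincherle 2 = (alpha * (1 + alpha) / 2)%:P].
Proof.
split; apply: poly_ext => z; have [c0 c1 c2 _] := generated_coef_rec (HP z);
  rewrite /pincherle hornerZ hornerC.
- by rewrite c0 expr0 mulr1.
- by rewrite c1 expr1 mulrNN mul1r.
- by rewrite c2 sqrrN expr1n mul1r.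
Qed.

Lemma pincherle_rec m : pincherle m.+3 =
  pincherle_a m *: pincherle m.+2 + pincherle_b m *: ('X * pincherle m).
Proof.
apply: poly_ext => z; have [_ _ _ /(_ m) E] := generated_coef_rec (HP z).
have {E} : (P m.+3).[z] =
  - (pincherle_a m * (P m.+2).[z] + pincherle_b m * (z * (P m).[z])).
  apply: (@mulfI _ m.+3%:R); first by rewrite pnatr_eq0.
  by rewrite E /pincherle_a /pincherle_b; field.
rewrite /pincherle !(hornerD, hornerZ, hornerM, hornerX) => ->.
by rewrite !exprS; ring.
Qed.

Lemma trinomial_pincherle : trinomial_sequence pincherle_a pincherle_b pincherle.
Proof.
split.
- by move=> m; rewrite divr_gt0// ?ltr0n// addr_gt0.
- move=> m; rewrite divr_gt0 ?ltr0n// ltr_wpDl//.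
  by rewrite mulr_gt0.
- have [p0 p1 p2] := pincherle_init.
  case=> [|[|[|//]]] _; [exists 1|exists alpha|exists (alpha * (1 + alpha) / 2)] => //.
  by rewrite divr_gt0// mulr_gt0// addr_gt0.
- exact: pincherle_rec.
Qed.

End generating_function.

(** * Location and number of the zeros *)

Section pincherle_zeros.
Variables (R : realType) (alpha : R) (P : nat -> {poly R}).
Hypothesis alpha_gt0 : 0 < alpha.
Hypothesis HP : generated_by alpha P.
Let Q := pincherle P.
Let TQ := trinomial_pincherle alpha_gt0 HP.

Let recQ m z : (Q m.+3).[z] =
  pincherle_a alpha m * (Q m.+2).[z] + pincherle_b alpha m * (z * (Q m).[z]).
Proof. by rewrite /Q (trin_rec TQ) !(hornerD, hornerZ, hornerM, hornerX). Qed.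

Let Q_const m : (m < 3)%N -> exists2 c, 0 < c & Q m = c%:P.
Proof. exact: (trin_init TQ). Qed.

(* At z = - 4/27, 1 - t - z t^3 = (1 - 2t/3)^2 (1 + t/3) has a double root, whence
   the recurrence of order two below. *)
Lemma pincherle_critical_gt0 m : 0 < (Q m).[- (4 / 27)].
Proof.
set z := - _; pose y n := (Q n).[z].
have a0 := alpha_gt0.
have S n : 9 / 2 * (n%:R + 2) * y n.+2 =
    3 / 2 * (n%:R + 1 + 3 * alpha) * y n.+1 + (n%:R + 3 * alpha) * y n.
  elim: n => [|n IH].
    have [q0 q1 q2] := pincherle_init HP.
    by rewrite /y /Q q0 q1 q2 !hornerC; field.
  have n3 : n%:R + 3 != 0 :> R by rewrite gt_eqF// ltr_wpDl.
  rewrite /y recQ -!/(y _) /pincherle_a /pincherle_b.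
  have -> : n.+1%:R = n%:R + 1 :> R by rewrite -natr1.
  have -> : n.+3%:R = n%:R + 3 :> R by rewrite -!natr1; ring.
  have -> : n.+2%:R = n%:R + 2 :> R by rewrite -!natr1; ring.
  have -> : 9 / 2 * (n%:R + 1 + 2) * ((n%:R + 2 + alpha) / (n%:R + 3) * y n.+2 +
      (n%:R + 3 * alpha) / (n%:R + 3) * (z * y n)) =
      9 / 2 * (n%:R + 2 + alpha) * y n.+2 - 2 / 3 * ((n%:R + 3 * alpha) * y n).
    by rewrite /z; field.
  have -> : (n%:R + 3 * alpha) * y n = 9 / 2 * (n%:R + 2) * y n.+2
    - 3 / 2 * (n%:R + 1 + 3 * alpha) * y n.+1 by rewrite IH; ring.
  by field.
suff H n : 0 < y n /\ 0 < y n.+1 by have [] := H m.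
elim: n => [|n [y0 y1]].
  have [q0 q1 _] := pincherle_init HP.
  by rewrite /y /Q q0 q1 !hornerC.
split=> //; have n0 : 0 <= n%:R :> R by [].
rewrite -(@pmulr_rgt0 _ (9 / 2 * (n%:R + 2))); last by lra.
by rewrite S addr_gt0// mulr_gt0//; lra.
Qed.

(** By induction [Q m.+2] is positive on [-4/27, z], so for negative z the ratio of [Q m.+3] to it
    increases from its positive value at -4/27. *)
Lemma pincherle_gt0 m z : - (4 / 27) <= z -> 0 < (Q m).[z].
Proof.
elim/ltn_ind: m z => m IH z z0.
have [m3|m3] := ltnP m 3.
  by have [c c0 ->] := Q_const m3; rewrite hornerC.
have [zp|zn] := leP 0 z; first exact: (trinomial_gt0 TQ).
move: z0; rewrite le_eqVlt => /predU1P[<-|z0]; first exact: pincherle_critical_gt0.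
case: m m3 IH => [|[|[|m]]]// _ IH.
have : (Q m.+3).[- (4 / 27)] / (Q m.+2).[- (4 / 27)] < (Q m.+3).[z] / (Q m.+2).[z].
  apply: ratio_wronskian_lt => // u; rewrite in_itv/= => /andP[u1 u2].
    by have [] := trinomial_wronskian_gt0 TQ m (lt_trans u2 zn).
  by rewrite gt_eqF// IH.
have d0 : 0 < (Q m.+3).[- (4 / 27)] / (Q m.+2).[- (4 / 27)].
  by rewrite divr_gt0// pincherle_critical_gt0.
by move=> /(lt_trans d0); rewrite pmulr_lgt0// invr_gt0 IH// ltW.
Qed.

Lemma pincherle_root_lt m (w : R[i]) :
  root (map_poly (real_complex R) (Q m)) w ->
  exists2 r : R, r < - (4 / 27) & w = real_complex R r.
Proof.
move=> rw; have := trinomial_real_rooted TQ rw.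
case: w rw => r i /= rw i0; exists r; last by rewrite i0.
rewrite ltNge; apply/negP => /(pincherle_gt0 m).
move: rw; rewrite i0 rootE horner_map /= => /eqP[] ->; by rewrite ltxx.
Qed.

Lemma pincherle_simple m z : z < 0 -> root (Q m) z -> (Q m)^`().[z] != 0.
Proof.
move=> z0 rz; have [m3|m3] := ltnP m 3; last exact: (trinomial_root_simple TQ).
by have [c c0 E] := Q_const m3; move: rz; rewrite E rootC gt_eqF.
Qed.

Let sizeQ m z := size (polyrcf.roots (Q m) z 0).

Lemma pincherle_zero_count_cvg z x : 0 < x -> x < 3 -> 1 + x + z * x ^+ 3 = 0 ->
  (sizeQ m z)%:R / m%:R @[m --> \oo] --> acos (Num.sqrt (1 + x) / 2) / pi.
Proof.
move=> x0 x3 xz.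
have xn0 : x != 0 by rewrite gt_eqF.
have zE : z = - (x^-1 ^+ 2 * (1 + x^-1)).
  have -> : z = (z * x ^+ 3) / x ^+ 3 by field.
  have -> : z * x ^+ 3 = - (1 + x) by lra.
  by field.
have z0 : z < 0 by rewrite zE oppr_lt0 mulr_gt0// ?exprn_gt0 ?addr_gt0 ?invr_gt0.
have Q0 m : 0 < (Q m).[0] by apply: (trinomial_gt0 TQ).
have itv_neg u : u \in `]z, 0[ -> u < 0 by rewrite in_itv/= => /andP[].
have k3 : 1 / 3 < x^-1 by rewrite mul1r ltf_pV2 ?posrE.
(* The index starts at 2 because W(Q_2, Q_3) is the first Wronskian of neighbours that is positive:
   Q_0, Q_1 and Q_2 are constants. *)
have := @winding_cvg R x^-1 (fun m => (Q m.+2).[z]) (fun m => sizeQ m.+2 z) k3.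
rewrite invrK => W.
have {}W : (sizeQ m.+2 z)%:R / m%:R @[m --> \oo] --> acos (Num.sqrt (1 + x) / 2) / pi.
  apply: W.
  - move=> m; apply: size_roots_interlaced => // u /itv_neg u0.
    by have [] := trinomial_wronskian_gt0 TQ m u0.
  - move=> m.
    suff /andP[] : (sizeQ m.+2 z <= sizeQ m.+4 z <= (sizeQ m.+2 z).+1)%N by [].
    apply: size_roots_interlaced => // u /itv_neg u0.
    by have [] := trinomial_wronskian_gt0 TQ m.+1 u0.
  - move=> m; apply: sign_size_roots => // u /itv_neg; exact: pincherle_simple.
  - move=> m; apply/orP; rewrite -negb_and; apply/negP => /andP[/eqP h1 /eqP h2].
    have [+ _] := trinomial_wronskian_gt0 TQ m z0.
    by rewrite /wronskian !(hornerD, hornerN, hornerM) -/Q h1 h2 mul0r mulr0 subrr ltxx.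
  - move=> e e0.
    (* Both recurrence coefficients tend to 1: at this index they differ from it by (alpha - 1) / (m
       + 5) and 3 (alpha - 1) / (m + 5). *)
    pose C := `|alpha - 1| * (1 + 3 * `|z|).
    have C0 : 0 <= C by rewrite mulr_ge0// addr_ge0// mulr_ge0.
    have [M _ HM] := nbhs_infty_ger (C / e).
    exists M => m /HM/= Mm.
    have m5 : 0 < m%:R + 5 :> R by rewrite ltr_wpDl.
    have -> : (Q m.+4.+1).[z] - (Q m.+4).[z] + x^-1 ^+ 2 * (1 + x^-1) * (Q m.+2).[z] =
      (alpha - 1) / (m%:R + 5) * ((Q m.+4).[z] + 3 * z * (Q m.+2).[z]).
      have -> : x^-1 ^+ 2 * (1 + x^-1) = - z by rewrite zE opprK.
      rewrite recQ /pincherle_a /pincherle_b.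
      have -> : m.+4.+1%:R = m%:R + 5 :> R by rewrite -!natr1; ring.
      have -> : m.+4%:R = m%:R + 4 :> R by rewrite -!natr1; ring.
      have -> : m.+2%:R = m%:R + 2 :> R by rewrite -!natr1; ring.
      by field; rewrite gt_eqF.
    have Ce : C <= e * (m%:R + 5).
      move: Mm; rewrite ler_pdivrMr// => ?; have := ltW e0; lra.
    set y4 := (Q m.+4).[z]; set y2 := (Q m.+2).[z].
    rewrite !normrM normfV (gtr0_norm m5) mulrAC ler_pdivrMr//.
    have yy : `|y4 + 3 * z * y2| <= (1 + 3 * `|z|) * (`|y4| + `|y2|).
      rewrite (le_trans (ler_normD _ _))// !normrM (ger0_norm (ler0n _ 3)).
      have := normr_ge0 y4; have := normr_ge0 y2; have := normr_ge0 z => *.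
      by nra.
    apply: le_trans (ler_wpM2l (normr_ge0 _) yy) _.
    by rewrite mulrA -/C [leRHS]mulrAC ler_wpM2r// addr_ge0.
(* This factor corrects the denominator for the shift of the index by 2. *)
have m2 : m%:R / (m + 2)%:R @[m --> \oo] --> (1 : R).
  have -> : (fun m => m%:R / (m + 2)%:R) = (fun m => 1 - 2 * @harmonic R m.+1).
    apply/funext => m; rewrite /harmonic/= addn2 -[m.+2%:R]natr1 -natr1.
    have : m%:R + 1 + 1 != 0 :> R by rewrite !natr1 pnatr_eq0.
    by move=> ?; field.
  rewrite -[X in _ --> X](_ : 1 - 2 * 0 = 1 :> R); last by rewrite mulr0 subr0.
  apply: cvgB; first exact: cvg_cst.
  have h := @cvg_harmonic R; rewrite -(cvg_shiftS (@harmonic R)) in h.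
  exact: cvgMr h.
have h := cvgM W m2; rewrite mulr1 in h.
have : (fun m => (sizeQ (m + 2) z)%:R / (m + 2)%:R : R) @ \oo -->
    acos (Num.sqrt (1 + x) / 2) / pi.
apply: (cvg_trans _ (h _)); apply: near_eq_cvg; near=> m.
  rewrite /= addn2 mulrA divfK// pnatr_eq0 -lt0n.
  by near: m; exact: nbhs_infty_gt.
by rewrite (cvg_shiftn 2 (fun m => (sizeQ m z)%:R / m%:R : R)).
Unshelve. all: by end_near. Qed.

End pincherle_zeros.

(** * The real root of the cubic and the density *)

Section cubic.
Variable R : realType.
Implicit Types (x t z : R).

Lemma cbrtK x : cbrt x ^+ 3 = x.
Proof.
have h : (`|x| `^ 3^-1) ^+ 3 = `|x|.
  by rewrite -powR_mulrn ?powR_ge0// -powRrM mulVf ?pnatr_eq0// powRr1.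
rewrite /cbrt exprMn h [RHS]numEsg; congr (_ * _).
by case: sgrP => _; rewrite ?expr0n ?expr1n//=; ring.
Qed.

Lemma cbrt_gt0 x : 0 < x -> 0 < cbrt x.
Proof. by move=> x0; rewrite /cbrt gtr0_sg// mul1r powR_gt0// normr_gt0 gt_eqF. Qed.

(** At z = -4/27 the cubic has the root 3 and the double root -3/2. Measured from there, the
    equation equates a quantity of sign opposite to t with one having the sign of t - 3 or zero. *)
Lemma cubic_root_itv z t : z < - (4 / 27) -> 1 + t + z * t ^+ 3 = 0 -> 0 < t < 3.
Proof.
move=> z0 tz; have E : (z + 4 / 27) * t ^+ 3 = 4 / 27 * ((t - 3) * (t + 3 / 2) ^+ 2).
  by rewrite -[LHS]addr0 -[X in _ + X]oppr0 -[X in - X]tz; field.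
have sq := sqr_ge0 (t + 3 / 2).
have z1 : z + 4 / 27 < 0 by lra.
apply/andP; split; rewrite ltNge; apply/negP => h.
  have [t0|tn0] := eqVneq t 0; first by move: tz; rewrite t0 expr0n /= => ?; lra.
  have t0 : t < 0 by rewrite lt_neqAle tn0.
  have t3 : t ^+ 3 < 0 by rewrite exprS nmulr_rlt0// -sqrrN exprn_gt0// oppr_gt0.
  have : 0 < (z + 4 / 27) * t ^+ 3 by rewrite nmulr_rgt0.
  have : (t - 3) * (t + 3 / 2) ^+ 2 <= 0 by apply: mulr_le0_ge0 => //; lra.
  by rewrite E; lra.
have t3 : 0 < t ^+ 3 by rewrite exprn_gt0//; lra.
have : (z + 4 / 27) * t ^+ 3 < 0 by rewrite nmulr_rlt0.
have : 0 <= (t - 3) * (t + 3 / 2) ^+ 2 by apply: mulr_ge0 => //; lra.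
by rewrite E; lra.
Qed.

(** Subtracting the equations leaves the factor 1 + z (s^2 + s t + t^2), which is negative since 1 +
    z s^2 = - 1 / s and s, t > 0. *)
Lemma cubic_root_unique z s t : z < - (4 / 27) ->
  1 + s + z * s ^+ 3 = 0 -> 1 + t + z * t ^+ 3 = 0 -> s = t.
Proof.
move=> z0 sz tz; have /andP[s0 s3] := cubic_root_itv z0 sz.
have /andP[t0 t3] := cubic_root_itv z0 tz.
have : (s - t) * (1 + z * (s ^+ 2 + s * t + t ^+ 2)) = 0.
  have -> : (s - t) * (1 + z * (s ^+ 2 + s * t + t ^+ 2)) =
    (1 + s + z * s ^+ 3) - (1 + t + z * t ^+ 3) by ring.
  by rewrite sz tz subrr.
move=> /eqP; rewrite mulf_eq0 subr_eq0 => /orP[/eqP//|/eqP E].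
have z0' : z < 0 by lra.
have : 1 + z * s ^+ 2 < 0.
  have : s * (1 + z * s ^+ 2) = -1.
    have -> : s * (1 + z * s ^+ 2) = (1 + s + z * s ^+ 3) - 1 by ring.
    by rewrite sz sub0r.
  nra.
nra.
Qed.

(** Cardano's method: the root is A - B with 3 z A B = 1, which removes the linear term, and u
    solves the resolvent quadratic [uE]. *)
Lemma real_zeroP z : z < - (4 / 27) -> 1 + real_zero z + z * real_zero z ^+ 3 = 0.
Proof.
move=> z0; have zn0 : z != 0 by rewrite lt_eqF//; lra.
rewrite /real_zero; set u := _ - 9 * z ^+ 2.
have D0 : 0 <= 27 * z ^+ 4 + 4 * z ^+ 3.
  have -> : 27 * z ^+ 4 + 4 * z ^+ 3 = (- z) * (z * z) * (- (27 * z + 4)) by ring.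
  by apply: mulr_ge0; [apply: mulr_ge0; [lra|rewrite -expr2 sqr_ge0]|lra].
have uE : u ^+ 2 + 18 * z ^+ 2 * u - 12 * z ^+ 3 = 0.
  have : (u + 9 * z ^+ 2) ^+ 2 = 3 * (27 * z ^+ 4 + 4 * z ^+ 3).
    by rewrite /u subrK exprMn !sqr_sqrtr.
  move=> E; have -> : u ^+ 2 + 18 * z ^+ 2 * u - 12 * z ^+ 3 =
    (u + 9 * z ^+ 2) ^+ 2 - 3 * (27 * z ^+ 4 + 4 * z ^+ 3) by ring.
  by rewrite E subrr.
have un0 : u != 0.
  apply: contraNneq zn0 => u0; move: uE; rewrite u0.
  rewrite expr0n/= mulr0 addr0 sub0r => /eqP; rewrite oppr_eq0 mulf_eq0.
  by rewrite pnatr_eq0/= expf_eq0/=.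
have cE := cbrtK u; move: (cbrt u) cE => c cE.
have cn0 : c != 0 by apply: contraNneq un0 => c0; rewrite -cE c0 expr0n.
have dE := cbrtK (2 / 3); set d := cbrt (2 / 3) in dE *.
have d0 : 0 < d by apply: cbrt_gt0; rewrite divr_gt0.
(* Both sides have cube 18, so a single cube root d of 2/3 serves A and B. *)
have -> : cbrt 2 * 3 `^ (2 / 3) = 3 * d.
  apply/eqP; rewrite -(@eqrXn2 _ 3)//; last 2 first.
  - by rewrite mulr_ge0 ?powR_ge0// ltW// cbrt_gt0.
  - by rewrite mulr_ge0// ltW.
  rewrite (exprMn 3 (cbrt 2)) (exprMn 3 3 d) (cbrtK 2) dE.
  rewrite -powR_mulrn ?powR_ge0// -powRrM divfK ?pnatr_eq0//.
  by rewrite powR_mulrn//; apply/eqP; field.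
have dn0 : d != 0 by rewrite gt_eqF.
move: (d) dE dn0 => {d0}d dE dn0.
set A := c / _; set B := d / c.
have AB : 3 * z * A * B = 1 by rewrite /A /B; field; rewrite cn0 zn0 dn0.
have A3 : A ^+ 3 = u / (18 * z ^+ 3).
  by rewrite /A expr_div_n !exprMn cE dE; field.
have B3 : B ^+ 3 = 2 / (3 * u) by rewrite /B expr_div_n cE dE; field.
have -> : 1 + (A - B) + z * (A - B) ^+ 3 =
  1 + z * (A ^+ 3 - B ^+ 3) + (A - B) * (1 - 3 * z * A * B) by ring.
rewrite AB subrr mulr0 addr0 A3 B3.
have -> : 1 + z * (u / (18 * z ^+ 3) - 2 / (3 * u)) =
    (u ^+ 2 + 18 * z ^+ 2 * u - 12 * z ^+ 3) / (18 * z ^+ 2 * u).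
  by field; rewrite zn0 un0.
by rewrite uE mul0r.
Qed.

End cubic.

Section density.
Variable R : realType.
Implicit Types (f : R -> R) (x z l : R).

Lemma is_derive_quotientP f z l :
  h^-1 * (f (z + h) - f z) @[h --> 0^'] --> l <-> is_derive z (1 : R) f l.
Proof.
have E : (fun h : R => h^-1 *: ((f \o shift z) (h *: (1 : R)) - f z)) =
    (fun h => h^-1 * (f (z + h) - f z)).
  by apply/funext => h /=; rewrite [h *: 1]mulr1 [h + z]addrC.
split=> [fl|[/cvg_ex[/= m]]].
  split; first by apply/cvg_ex; exists l; rewrite E.
  by rewrite /derive E; apply: (cvg_lim (@Rhausdorff R)).
by rewrite /derive E => fm <-; rewrite (cvg_lim (@Rhausdorff R) fm).
Qed.

Lemma real_zero_itv z : z < - (4 / 27) -> 0 < real_zero z < 3.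
Proof. by move=> z0; apply: (cubic_root_itv z0); exact: real_zeroP. Qed.

(** Subtracting the equations at z + h and z gives (x1 - x) q(x1) = - h x1^3, where q is the divided
    difference of the cubic. Since q <= - 1 / x on the positive axis, this yields first continuity,
    then the limit of the quotient. *)
Lemma is_derive_real_zero z : z < - (4 / 27) ->
  is_derive z (1 : R) (@real_zero R)
    (- (real_zero z ^+ 3 / (1 + 3 * z * real_zero z ^+ 2))).
Proof.
move=> z0; set x := real_zero z.
have xz : 1 + x + z * x ^+ 3 = 0 by exact: real_zeroP.
have /andP[x0 x3] : 0 < x < 3 by exact: real_zero_itv.
have zn : z < 0 by lra.
pose q (x1 : R) := 1 + z * (x1 ^+ 2 + x1 * x + x ^+ 2).
have xV : 1 + z * x ^+ 2 = - x^-1.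
  apply: (mulfI (lt0r_neq0 x0)); rewrite mulrN divff ?lt0r_neq0//.
  by apply/eqP; rewrite -subr_eq0 opprK; apply/eqP; rewrite -[RHS]xz; ring.
have q_lt x1 : 0 < x1 -> q x1 <= - x^-1.
  move=> x10; rewrite -xV /q.
  have : z * (x1 ^+ 2 + x1 * x) <= 0.
    by rewrite mulr_le0_ge0// ?ltW// addr_gt0// ?mulr_gt0// exprn_gt0.
  by lra.
have diff h : z + h < - (4 / 27) ->
    (real_zero (z + h) - x) * q (real_zero (z + h)) = - h * real_zero (z + h) ^+ 3.
  move=> zh; have := real_zeroP zh; set x1 := real_zero (z + h) => E.
  have -> : - h * x1 ^+ 3 =
    (1 + x1 + z * x1 ^+ 3) - (1 + x1 + (z + h) * x1 ^+ 3) by ring.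
  rewrite E -[X in _ = _ - X]xz /q; ring.
have near_dom : \forall h \near (0 : R), z + h < - (4 / 27).
  have zc : z + h @[h --> (0 : R)] --> z + 0.
    by apply: cvgD; [exact: cvg_cst|exact: cvg_id].
  by rewrite addr0 in zc; move/cvgr_lt: zc => /(_ _ z0).
have cont : real_zero (z + h) @[h --> (0 : R)] --> x.
  apply/cvgrPdist_le => e e0; near=> h.
  have zh : z + h < - (4 / 27) by near: h.
  (* Here 81 = 27 * 3, from x1^3 <= 27 and |q(x1)| >= 1/3. *)
  have he : `|h| <= e / 81.
    near: h; apply/nbhs_ballP; exists (e / 81); first by rewrite /= divr_gt0.
    by move=> h; rewrite /ball/= sub0r normrN => /ltW.
  have := diff h zh; have /andP[] := real_zero_itv zh.
  set x1 := real_zero (z + h) => x10 x13 D.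
  have qx := q_lt _ x10.
  have x27 : x1 ^+ 3 <= 27.
    have -> : 27 = 3 ^+ 3 :> R by ring.
    by rewrite lerXn2r ?nnegrE ?ltW.
  have V3 : 1 / 3 < x^-1 by rewrite mul1r ltf_pV2 ?posrE.
  have qn : 1 / 3 <= `|q x1|.
    rewrite ler0_norm; first by apply: le_trans (ltW V3) _; rewrite lerNr.
    by apply: le_trans qx _; rewrite oppr_le0 invr_ge0 ltW.
  have h1 : `|x1 - x| * `|q x1| = `|h| * x1 ^+ 3.
    by rewrite -normrM D normrM normrN (gtr0_norm (exprn_gt0 3 x10)).
  have h2 := ler_wpM2l (normr_ge0 (x1 - x)) qn.
  have h3 := ler_wpM2l (normr_ge0 h) x27.
  rewrite distrC; move: h1 h2 h3 he; clear; lra.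
have qc : q (real_zero (z + h)) @[h --> (0 : R)] --> 1 + 3 * z * x ^+ 2.
  have -> : 1 + 3 * z * x ^+ 2 = q x by rewrite /q; ring.
  apply: (cvg_comp _ _ cont); rewrite /q.
  apply: cvgD; first exact: cvg_cst.
  apply: cvgM; first exact: cvg_cst.
  apply: cvgD; last exact: cvg_cst.
  apply: cvgD; first exact: exprn_continuous.
  by apply: cvgM; [exact: cvg_id|exact: cvg_cst].
have qx0 : 1 + 3 * z * x ^+ 2 != 0.
  have := q_lt _ x0; have : 0 < x^-1 by rewrite invr_gt0.
  have -> : 1 + 3 * z * x ^+ 2 = q x by rewrite /q; ring.
  by move=> ? ?; rewrite lt_eqF//; lra.
apply/is_derive_quotientP; rewrite -/x.
have lim : - (real_zero (z + h) ^+ 3 / q (real_zero (z + h))) @[h --> (0 : R)] -->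
    - (x ^+ 3 / (1 + 3 * z * x ^+ 2)).
  apply: cvgN; apply: cvgM; last by apply: cvgV qc.
  pose cube (y : R) := y ^+ 3.
  rewrite -[X in _ --> X]/(cube x).
  rewrite -[X in X @ _]/(fun h => cube (real_zero (z + h))).
  by apply: (cvg_comp _ _ cont); exact: exprn_continuous.
have {}lim : - (real_zero (z + h) ^+ 3 / q (real_zero (z + h))) @[h --> (0 : R)^'] -->
    - (x ^+ 3 / (1 + 3 * z * x ^+ 2)) by exact: cvg_within_filter.
apply: (cvg_trans _ lim); apply: near_eq_cvg.
near=> h.
have zh : z + h < - (4 / 27) by near: h; exact: cvg_within.
have h0 : h != 0 by near: h; exact: nbhs_dnbhs_neq.
have := diff h zh; have /andP[x10 _] := real_zero_itv zh.
have := q_lt _ x10; set x1 := real_zero _ => qx D.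
have q0 : q x1 != 0 by rewrite lt_eqF// (le_lt_trans qx)// oppr_lt0 invr_gt0.
apply: (mulIf q0); rewrite mulNr divfK//.
by rewrite -mulrA D mulNr mulrN mulrA mulVf// mul1r.
Unshelve. all: by end_near. Qed.

(** The argument in [0, pi] of the non-real roots of l^3 - l^2 - z when z < -4/27. *)
Definition angle z := acos (Num.sqrt (1 + real_zero z) / 2).

Lemma is_derive_angle z : z < - (4 / 27) ->
  is_derive z (1 : R) angle (- (pi / 3 * zero_density z)).
Proof.
move=> z0; have dx := is_derive_real_zero z0.
have /andP[x0 x3] := real_zero_itv z0; have xz := real_zeroP z0.
have x1 : 0 < 1 + real_zero z by rewrite addr_gt0.
have d1 : is_derive z (1 : R) (fun z => 1 + real_zero z)
   (- (real_zero z ^+ 3 / (1 + 3 * z * real_zero z ^+ 2))).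
  by have := is_deriveD (is_derive_cst (1 : R) z (1 : R)) dx; rewrite add0r.
have d2 := @is_derive1_comp _ _ _ z _ _ (is_derive1_sqrt x1) d1.
have d3 := is_deriveZ (2^-1) d2.
have s0 : 0 < Num.sqrt (1 + real_zero z) by rewrite sqrtr_gt0.
have s2 : Num.sqrt (1 + real_zero z) ^+ 2 = 1 + real_zero z by rewrite sqr_sqrtr ?ltW.
have aI : -1 < Num.sqrt (1 + real_zero z) / 2 < 1.
  by apply/andP; split; nra.
have -> : angle = @acos R \o (2^-1 \*: (Num.sqrt \o (fun z => 1 + real_zero z))).
  by apply/funext => u; rewrite /angle /= mulrC.
have aI' : -1 < 2^-1 * Num.sqrt (1 + real_zero z) < 1 by rewrite mulrC.
have d4 := @is_derive1_comp _ (@acos R) _ z _ _ (is_derive1_acos aI') d3.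
apply: (@is_derive_eq _ _ _ _ _ _ _ _ d4).
rewrite /GRing.scale /= /zero_density.
move: (real_zero z) x0 x3 xz x1 s0 s2 => x x0 x3 xz x1 s0 s2.
rewrite [x + 1]addrC; move: (Num.sqrt (1 + x)) s0 s2 => S s0 s2.
have t0 : 0 < Num.sqrt (3 - x) by rewrite sqrtr_gt0 subr_gt0.
have t2 : Num.sqrt (3 - x) ^+ 2 = 3 - x by rewrite sqr_sqrtr// subr_ge0 ltW.
have -> : Num.sqrt (1 - (2^-1 * S) ^+ 2) = Num.sqrt (3 - x) / 2.
  have -> : 1 - (2^-1 * S) ^+ 2 = (Num.sqrt (3 - x) / 2) ^+ 2.
    by rewrite !(exprMn, expr_div_n) s2 t2; field.
  by rewrite sqrtr_sqr ger0_norm// divr_ge0// ltW.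
move: (Num.sqrt (3 - x)) t0 {t2} => T t0.
have xn0 : x != 0 by rewrite gt_eqF.
(* Eliminating z by the cubic leaves a rational identity in x, S and T, with S^2 = 1 + x. *)
have -> : z = - S ^+ 2 / x ^+ 3.
  have -> : z = (z * x ^+ 3) / x ^+ 3 by field.
  by congr (_ / _); rewrite s2; lra.
have -> : 1 + 3 * (- S ^+ 2 / x ^+ 3) * x ^+ 2 = - (3 + 2 * x) / x.
  by rewrite s2; field.
have x32 : 0 < 3 + 2 * x by lra.
move: (pi : R) (pi_gt0 R) => p p0.
field.
rewrite !gt_eqF//.
Qed.

End density.

(** * Zero counts on intervals and the limiting density *)

Lemma mup_simple_root (F : fieldType) (p : {poly F}) x :
  root p x -> p^`().[x] != 0 -> mup x p = 1%N.
Proof.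
move=> px p'x; have p0 : p != 0.
  by apply: contraNneq p'x => ->; rewrite deriv0 horner0.
apply/eqP; rewrite eqn_leq -XsubC_dvd// dvdp_XsubCl px andbT -ltnS mup_ltn//.
apply: contra p'x => /dvdpP[q ->].
rewrite expr2 mulrA derivM derivXsubC mulr1 hornerD !hornerM hornerXsubC.
by rewrite subrr !mulr0 addr0.
Qed.

Lemma size_roots_cat (R : rcfType) (p : {poly R}) a u b : p != 0 -> a < u < b ->
  size (roots p a b) = (size (roots p a u) + root p u + size (roots p u b))%N.
Proof.
move=> p0 /andP[au ub].
pose s := roots p a u ++ nseq (root p u) u ++ roots p u b.
have -> : (size (roots p a u) + root p u + size (roots p u b))%N = size s.
  by rewrite !size_cat size_nseq addnA.
apply/perm_size/uniq_perm.
- exact: uniq_roots.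
- rewrite !cat_uniq !uniq_roots /= andbT.
  have -> : uniq (nseq (root p u) u) by case: (root p u).
  rewrite has_cat negb_or /= -andbA; apply/and3P; split; apply/hasPn => v.
  + rewrite mem_nseq => /andP[_ /eqP->]; rewrite in_roots.
    by rewrite in_itv/= ltxx !andbF.
  + rewrite !in_roots !in_itv/= => /and3P[_ /andP[/ltW + _] _].
    by rewrite leNgt => /negPf->; rewrite !andbF.
  + rewrite in_roots in_itv/= mem_nseq => /and3P[_ /andP[+ _] _].
    by apply: contraTN => /andP[_ /eqP->]; rewrite ltxx.
- move=> v; rewrite !mem_cat mem_nseq !in_roots !in_itv/= p0 !andbT.
  have [->|vu] := eqVneq v u.
    by rewrite au ub ltxx; case: (root p u).
  rewrite andbF /=; case: (root p v) => //=.
  case: (ltgtP v u) vu => // [vu|uv] _.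
    by rewrite (lt_trans vu ub) !andbT orbF.
  by rewrite (lt_trans au uv) andbF.
Qed.

Section limiting_density.
Variable R : realType.

Lemma cvg_bounded_divn (C : R) (u : nat -> R) : (forall m, `|u m| <= C) ->
  u m / m%:R @[m --> \oo] --> (0 : R).
Proof.
move=> uC; apply/cvgrPdist_le => e e0; near=> m.
have m0 : 0 < m%:R :> R by rewrite ltr0n; near: m; exact: nbhs_infty_gt.
rewrite sub0r normrN normrM normfV (gtr0_norm m0) ler_pdivrMr//.
apply: le_trans (uC m) _; rewrite mulrC -ler_pdivrMr//.
by near: m; exact: nbhs_infty_ger.
Unshelve. all: by end_near. Qed.

Lemma cvg_divn_div (d : nat) : (0 < d)%N ->
  (m %/ d)%:R / m%:R @[m --> \oo] --> (d%:R^-1 : R).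
Proof.
move=> d0; have dR : 0 < d%:R :> R by rewrite ltr0n.
have h : (fun m => d%:R^-1 - (m %% d)%:R / d%:R / m%:R : R) @ \oo --> d%:R^-1 - (0 : R).
  apply: cvgB; first exact: cvg_cst.
  apply: (@cvg_bounded_divn 1) => m.
  by rewrite ger0_norm ?divr_ge0// ler_pdivrMr// mul1r ler_nat ltnW// ltn_mod.
rewrite subr0 in h; apply: (cvg_trans _ h); apply: near_eq_cvg; near=> m.
have m0 : m%:R != 0 :> R by rewrite pnatr_eq0 -lt0n; near: m; exact: nbhs_infty_gt.
have E : m%:R = (m %/ d)%:R * d%:R + (m %% d)%:R :> R.
  by rewrite -natrM -natrD -divn_eq.
have -> : (m %% d)%:R = m%:R - (m %/ d)%:R * d%:R :> R by rewrite [in RHS]E addrC addKr.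
by field; rewrite m0 gt_eqF.
Unshelve. all: by end_near. Qed.

Variables (alpha : R) (P : nat -> {poly R}).
Hypothesis alpha_gt0 : 0 < alpha.
Hypothesis HP : generated_by alpha P.

Let sgn_neq0 m : (-1) ^+ m != 0 :> R. Proof. by rewrite signr_eq0. Qed.

Lemma nb_zeros_pincherle m z u : u <= 0 ->
  nb_zeros (P m) z u = size (roots (pincherle P m) z u).
Proof.
move=> u0; rewrite /pincherle rootsZ// /nb_zeros -sum1_size big_seq [RHS]big_seq.
apply: eq_bigr => r rr; apply: mup_simple_root; first exact: root_roots rr.
have := roots_in rr; rewrite in_itv/= => /andP[_ ru].
have rP := root_roots rr.
have := @pincherle_simple _ _ _ alpha_gt0 HP m r (lt_le_trans ru u0).
by rewrite /pincherle rootZ// derivZ hornerZ mulf_eq0 negb_or sgn_neq0 /=; apply.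
Qed.

(** The zeros in ]z, u[ are those in ]z, 0[ minus those in ]u, 0[ and a possible zero at u, which is
    negligible after division by m. The factor 3 comes from normalising by the integer part of m /
    3. *)
Lemma nb_zeros_cvg z u : z < u -> u < - (4 / 27) ->
  (nb_zeros (P m) z u)%:R / (m %/ 3)%:R @[m --> \oo] --> 3 / pi * (angle z - angle u).
Proof.
move=> zu u0; have z0 := lt_trans zu u0; have un : u < 0 by lra.
have pi0 : pi != 0 :> R by rewrite gt_eqF// pi_gt0.
have count v : v < - (4 / 27) ->
    (size (roots (pincherle P m) v 0))%:R / m%:R @[m --> \oo] --> angle v / pi.
  move=> v0; have /andP[? ?] := real_zero_itv v0.
  apply: (pincherle_zero_count_cvg alpha_gt0 HP) => //; exact: real_zeroP.
have rt : (root (pincherle P m) u)%:R / m%:R @[m --> \oo] --> (0 : R).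
  by apply: (@cvg_bounded_divn 1) => m; case: root; rewrite ?normr0 ?normr1.
have V : ((m %/ 3)%:R / m%:R)^-1 @[m --> \oo] --> ((3 : R)^-1)^-1.
  by apply: cvgV; [rewrite invr_eq0|exact: cvg_divn_div].
have -> : 3 / pi * (angle z - angle u) = (angle z / pi - angle u / pi - 0) * (3^-1)^-1.
  by move: (pi : R) pi0 => p p0; field.
apply: (cvg_trans _ (cvgM (cvgB (cvgB (count z z0) (count u u0)) rt) V)).
apply: near_eq_cvg; near=> m.
have m0 : m%:R != 0 :> R by rewrite pnatr_eq0 -lt0n; near: m; exact: nbhs_infty_gt.
have q0 : pincherle P m != 0.
  have : 0 < (pincherle P m).[0] by apply: (pincherle_gt0 alpha_gt0 HP); lra.
  by apply: contraTneq => ->; rewrite horner0 ltxx.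
rewrite nb_zeros_pincherle ?ltW//=.
have -> : (size (roots (pincherle P m) z u))%:R = (size (roots (pincherle P m) z 0))%:R
    - (size (roots (pincherle P m) u 0))%:R - (root (pincherle P m) u)%:R :> R.
  by rewrite (@size_roots_cat _ _ z u 0 q0) ?zu// !natrD; ring.
by rewrite invf_div -!mulrBl mulrA divfK.
Unshelve. all: by end_near. Qed.

Lemma limiting_density z : z < - (4 / 27) ->
  is_limiting_density P z (zero_density z).
Proof.
move=> z0; exists (fun eps => 3 / pi * (angle z - angle (z + eps))); split.
  near=> eps; apply: nb_zeros_cvg.
    by rewrite ltrDl; near: eps; exact: nbhs_right_gt.
  rewrite -ltrBrDl; near: eps; apply: nbhs_right_lt.
  by rewrite subr_gt0.
have /is_derive_quotientP/cvg_dnbhs_at_right h := is_derive_angle z0.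
have pi0 : pi != 0 :> R by rewrite gt_eqF// pi_gt0.
have -> : zero_density z = - (3 / pi) * - (pi / 3 * zero_density z).
  by move: (zero_density z) => d; move: (pi : R) pi0 => p p0; field.
have -> : (fun eps => eps^-1 * (3 / pi * (angle z - angle (z + eps)))) =
    (fun eps => - (3 / pi) * (eps^-1 * (angle (z + eps) - angle z))).
  by apply/funext => eps; ring.
exact: cvgMr h.
Unshelve. all: by end_near. Qed.

End limiting_density.

Unset Implicit Arguments.
Set Strict Implicit.

Theorem theorem2 (R : realType) (alpha : R) (P : nat -> {poly R})
    (halpha : 0 < alpha < 1) (hP : generated_by alpha P) :
  [/\ \forall m \near \oo, forall w : R[i],
        root (map_poly (real_complex R) (P m)) w ->
        exists2 r : R, r < - (4 / 27) & w = real_complex R r,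
      forall z : R, z < - (4 / 27) ->
        is_limiting_density P z (zero_density z)
    & forall z : R, z < - (4 / 27) ->
        forall t : R, 1 + t + z * t ^+ 3 = 0 <-> t = real_zero z].
Proof.
have /andP[alpha_gt0 _] := halpha.
split.
- near=> m => w rw; apply: (pincherle_root_lt alpha_gt0 hP (m := m)).
  by rewrite /pincherle map_polyZ rootZ // fmorph_eq0 signr_eq0.
- by move=> z; exact: limiting_density hP z.
- move=> z z0 t; split=> [tz|->]; last exact: real_zeroP.
  exact: (cubic_root_unique z0 tz (real_zeroP z0)).
Unshelve. all: by end_near. Qed.
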